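(* Let $F(t^* )=U$ and $\tilde F(t^* )=\tilde U$ be, respectively, true and interpolated data on $\operatorname{St}(n,p)$ situated in a common neighborhood (that is, $\Phi_{(Q,S)}(U)$ and $\Phi_{(Q,S)}(\tilde U)$ both lie in the domain of $\psi_E$), with local coordinate matrices $X=\psi_E(\Phi_{(Q,S)}(U))$ and $\tilde X=\psi_E(\Phi_{(Q,S)}(\tilde U))$. Then the interpolation error on $\operatorname{St}(n,p)$ is bounded by $$\operatorname{dist}_E(F(t^* ),\tilde F(t^* ))\le 2\arcsin\left(\tfrac32\|X-\tilde X\|_F\right)=3\|X-\tilde X\|_F+\mathcal{O}(\|X-\tilde X\|_F^3).$$
   Context: Let $p\le n$ be positive integers, $\operatorname{St}(n,p)=\{U\in\mathbb{R}^{n\times p}:U^TU=I_p\}$ the Stiefel manifold, $E=\begin{bmatrix} I_p \\ 0 \end{bmatrix}\in\operatorname{St}(n,p)$, $O(n)$ the orthogonal group, and $\operatorname{skew}(p)$ the real skew-symmetric $p\times p$ matrices. $\operatorname{dist}_E$ is the Riemannian distance on $\operatorname{St}(n,p)$ for the Euclidean metric $g_e(\xi,\Delta)=\operatorname{tr}(\xi^T\Delta)$; $\|\cdot\|_F$ is the Frobenius norm; $\exp_m$ is the matrix exponential and $\log_m$ the principal matrix logarithm. Group action: fix $\hat U\in\operatorname{St}(n,p)$, let $Q\in O(n)$ satisfy $Q^T\hat U=\begin{bmatrix} \operatorname{diag}(\pm1,\dots,\pm1) \\ 0 \end{bmatrix}$, and let $S=E^TQ^T\hat U$. Then $\Phi_{(Q,S)}:\operatorname{St}(n,p)\to\operatorname{St}(n,p)$,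 $U\mapsto Q^TUS$, is a bijection with $\Phi_{(Q,S)}(\hat U)=E$. Polar-light coordinates around $E$: $$\psi_E\left(\begin{bmatrix} U_1 \\ U_2 \end{bmatrix}\right)=\begin{bmatrix} \log_m(U_1(U_1^TU_1)^{-1/2}) \\ U_2(U_1^TU_1)^{-1/2} \end{bmatrix},\qquad \varphi_E\left(\begin{bmatrix} A \\ B \end{bmatrix}\right)=\begin{bmatrix} \exp_m(A) \\ B \end{bmatrix}(I_p+B^TB)^{-1/2},$$ where $\psi_E$ is defined on those $\begin{bmatrix} U_1 \\ U_2 \end{bmatrix}\in\operatorname{St}(n,p)$, $U_1\in\mathbb{R}^{p\times p}$, with $U_1$ nonsingular and $U_1(U_1^TU_1)^{-1/2}$ having no eigenvalue $-1$, and $\varphi_E$ is defined for $(A,B)\in\operatorname{skew}(p)\times\mathbb{R}^{(n-p)\times p}$. Interpolant: $F:I\to\operatorname{St}(n,p)$ is an unknown (differentiable) function on an interval $I$, sampled at $t_1<\dots<t_m$, and the samples are mapped by $\Phi_{(Q,S)}$ to a neighborhood of $E$. With $X^{(i)}=\psi_E(\Phi_{(Q,S)}(F(t_i)))$ and $\gamma:I\to\operatorname{skew}(p)\times\mathbb{R}^{(n-p)\times p}$ an interpolant with $\gamma(t_i)=X^{(i)}$ for all $i$, constructed by any Euclidean interpolation scheme, the manifold interpolant is $\tilde F(t)=\Phi_{(Q,S)}^{-1}(\varphi_E(\gamma(t)))$, which satisfies $\tilde F(t_i)=F(t_i)$. Here $t^*\in I$. *)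

(* Defs.v *)
From HB Require Import structures.
From mathcomp Require Import all_boot all_order all_algebra.
From mathcomp Require Import complex.
From mathcomp Require Import all_classical all_reals all_analysis.
Import Order.TTheory GRing.Theory Num.Theory.
Import numFieldNormedType.Exports.

Set Implicit Arguments.
Unset Strict Implicit.
Unset Printing Implicit Defensive.

Local Open Scope classical_set_scope.
Local Open Scope ring_scope.

Section Matrices.
Variable R : realType.

Definition frob_inner n p (xi delta : 'M[R]_(n, p)) : R := \tr (xi^T *m delta).

Definition frob_norm n p (A : 'M[R]_(n, p)) : R := Num.sqrt (\tr (A^T *m A)).

Definition skew p (A : 'M[R]_p) : Prop := A^T = - A.

Definition orthogonal_mx n (Q : 'M[R]_n) : Prop := Q^T *m Q = 1%:M.

Definition psd_mx p (P : 'M[R]_p) : Prop :=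
  P^T = P /\ forall x : 'cV[R]_p, 0 <= (x^T *m P *m x) 0 0.

(* The positive semidefinite square root (unique when [A] is positive
   semidefinite, 0 by convention when there is none). *)
Definition sqrt_mx p (A : 'M[R]_p) : 'M[R]_p :=
  xget 0 [set P : 'M[R]_p | psd_mx P /\ P *m P = A].

Definition invsqrt_mx p (A : 'M[R]_p) : 'M[R]_p := invmx (sqrt_mx A).

Definition exp_mx p (A : 'M[R]_p) : 'M[R]_p :=
  limn (series (fun k : nat => (k`!%:R^-1 : R) *: A ^+ k)).

(* [X] is a logarithm of [M] all of whose complex eigenvalues lie in the open
   strip |Im z| < pi: this determines [X] when [M] has no eigenvalue in
   ]-oo, 0], and a real [M] then has a real principal logarithm. *)
Definition is_log_mx p (M X : 'M[R]_p) : Prop :=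
  exp_mx X = M /\
  forall z : R[i], eigenvalue (map_mx (real_complex R) X) z ->
    `|complex.Im z| < pi.

Definition log_mx p (M : 'M[R]_p) : 'M[R]_p := xget 0 [set X | is_log_mx M X].

End Matrices.

Section Stiefel.
Variable R : realType.

Definition St n p : set 'M[R]_(n, p) := [set U | U^T *m U = 1%:M].

(* Continuous on [0, 1] and C^1 on the pieces of a subdivision. By the mean
   value theorem, the existence of a continuous extension [d] of the derivative
   to a closed piece is C^1 regularity up to the end points of the piece. *)
Definition piecewise_C1 n p (c : R -> 'M[R]_(n, p)) : Prop :=
  {within `[0, 1], continuous c} /\
  exists s : seq R, itv_partition 0 1 s /\
    forall k, (k < size s)%N ->
      let a := nth 0 (0 :: s) k in
      let b := nth 0 (0 :: s) k.+1 in
      exists d : R -> 'M[R]_(n, p),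
        {within `[a, b], continuous d} /\
        forall t, t \in `]a, b[ -> is_derive t 1 c (d t).

(* [derive1 c] may be meaningless at the finitely many points of the subdivision,
   which do not contribute to the integral. *)
Definition curve_length n p (c : R -> 'M[R]_(n, p)) : \bar R :=
  (\int[lebesgue_measure]_(t in `[0%R, 1%R])
     (Num.sqrt (frob_inner (derive1 c t) (derive1 c t)))%:E)%E.

Definition St_curve n p (U V : 'M[R]_(n, p)) (c : R -> 'M[R]_(n, p)) : Prop :=
  [/\ piecewise_C1 c, forall t, t \in `[0, 1] -> St (c t), c 0 = U & c 1 = V].

(* Extended-real valued: St(p, p) = O(p) is not connected, and the distance
   between its two components is +oo. *)
Definition distE n p (U V : 'M[R]_(n, p)) : \bar R :=
  ereal_inf [set curve_length c | c in St_curve U V].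

Definition differentiable_within n p (I : set R) (F : R -> 'M[R]_(n, p)) : Prop :=
  forall t, I t -> exists d : 'M[R]_(n, p),
    (fun s => (s - t)^-1 *: (F s - F t)) @ within (I `\ t) (nbhs t) --> d.

End Stiefel.

(* In what follows St(n, p), p <= n, is presented as St(p + q, p), q = n - p,
   so that the upper p x p and lower (n - p) x p blocks of a matrix are given
   by [usubmx] and [dsubmx]. *)
Section Coordinates.
Variables (R : realType) (p q : nat).

Definition StE : 'M[R]_(p + q, p) := col_mx 1%:M 0.

Definition polar_factor (M : 'M[R]_p) : 'M[R]_p := M *m invsqrt_mx (M^T *m M).

Definition psi_dom : set 'M[R]_(p + q, p) :=
  [set U | [/\ St U, usubmx U \in unitmx &
               ~~ eigenvalue (polar_factor (usubmx U)) (-1)]].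

Definition psiE (U : 'M[R]_(p + q, p)) : 'M[R]_(p + q, p) :=
  let U1 := usubmx U in
  let U2 := dsubmx U in
  col_mx (log_mx (polar_factor U1))
         (U2 *m invsqrt_mx (U1^T *m U1)).

Definition phi_dom : set 'M[R]_(p + q, p) := [set X | skew (usubmx X)].

Definition phiE (X : 'M[R]_(p + q, p)) : 'M[R]_(p + q, p) :=
  let A := usubmx X in
  let B := dsubmx X in
  col_mx (exp_mx A) B *m invsqrt_mx (1%:M + B^T *m B).

Definition Phi (Q : 'M[R]_(p + q)) (S : 'M[R]_p) (U : 'M[R]_(p + q, p)) :
  'M[R]_(p + q, p) := Q^T *m U *m S.

Definition Phi_inv (Q : 'M[R]_(p + q)) (S : 'M[R]_p) (V : 'M[R]_(p + q, p)) :
  'M[R]_(p + q, p) := Q *m V *m invmx S.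

Lemma PhiK (Q : 'M[R]_(p + q)) (S : 'M[R]_p) :
  orthogonal_mx Q -> S \in unitmx -> cancel (Phi Q S) (Phi_inv Q S).
Proof.
move=> hQ hS U; rewrite /Phi /Phi_inv !mulmxA.
by rewrite (mulmx1C hQ) mul1mx mulmxK.
Qed.

Lemma Phi_invK (Q : 'M[R]_(p + q)) (S : 'M[R]_p) :
  orthogonal_mx Q -> S \in unitmx -> cancel (Phi_inv Q S) (Phi Q S).
Proof. by move=> hQ hS U; rewrite /Phi /Phi_inv !mulmxA hQ mul1mx mulmxKV. Qed.

Definition interpolant (Q : 'M[R]_(p + q)) (S : 'M[R]_p)
  (gamma : R -> 'M[R]_(p + q, p)) (t : R) : 'M[R]_(p + q, p) :=
  Phi_inv Q S (phiE (gamma t)).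

End Coordinates.

Arguments StE {R p q}.

(* Main.v *)
(* Write [h = |X - X~|_F], so that [h <= 2/3]. The polar-light chart at [E] is
   expansive. Indeed [U = M H^-1] with [M = col_mx O B], [O] orthogonal, and
   [H = (1 + B^T B)^(1/2) >= 1]; the projection [M |-> U] does not expand because
   [|U H - V G|^2 - |U - V|^2] is at least the trace of
   [(U - V) (H - 1 + G - 1) (U - V)^T >= 0], and neither does [exp] on skew matrices.
   Hence [|U - U~|_F <= h]. The polar factor of the chord from [U] to [U~] then is
   a smooth curve on the Stiefel manifold of length at most
   [|U - U~|_F / (1 - |U - U~|_F^2 / 4)^(1/2)], which is much less than [3 h], and
   [3 h <= 2 asin (3 h / 2)]. *)

Require Import Defs.
From HB Require Import structures.
From mathcomp Require Import all_boot all_order all_algebra.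
From mathcomp Require Import complex ring lra.
From mathcomp Require Import all_classical all_reals all_analysis.
From mathcomp Require Import measurable_realfun.
Import Order.TTheory GRing.Theory Num.Theory.
Import numFieldNormedType.Exports.

Local Open Scope classical_set_scope.
Local Open Scope ring_scope.

(** * Frobenius norm *)

(** The chart enters only through an inequality between Frobenius norms, so neither [log_mx] nor a
    matrix square root is ever differentiated; the only curve needed is one explicit competitor in
    the infimum defining [distE]. The obstacle is the logarithm. The non-expansiveness of [exp_mx]
    is a statement about skew matrices, whereas [log_mx] is some matrix picked by [xget] among those
    with the right exponential and spectrum, and nothing in that choice says that it is skew. A skew
    logarithm therefore has to be constructed, and then identified with the chosen one by a
    uniqueness theorem. The existence of [sqrt_mx] and of the skew logarithm both rest on the
    spectral theorem for real symmetric matrices. The bound [3 h / 2 <= 1], which is the domain of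
    the arcsine, is also what keeps the chord short: a chord of length at most 1 has a Gram matrix
    bounded below by 3/4, hence an invertible one. *)

Lemma frob_innerE {R : realType} {n p} (A B : 'M[R]_(n, p)) :
  frob_inner A B = \sum_i \sum_j A i j * B i j.
Proof.
rewrite /frob_inner /mxtrace exchange_big /=; apply: eq_bigr => j _.
by rewrite mxE; apply: eq_bigr => i _; rewrite mxE.
Qed.

Lemma frob_innerC {R : realType} {n p} (A B : 'M[R]_(n, p)) :
  frob_inner A B = frob_inner B A.
Proof. by rewrite /frob_inner -mxtrace_tr trmx_mul trmxK. Qed.

Lemma frob_innerDl {R : realType} {n p} (A B C : 'M[R]_(n, p)) :
  frob_inner (A + B) C = frob_inner A C + frob_inner B C.
Proof. by rewrite /frob_inner linearD mulmxDl mxtraceD. Qed.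

Lemma frob_innerZl {R : realType} {n p} a (A C : 'M[R]_(n, p)) :
  frob_inner (a *: A) C = a * frob_inner A C.
Proof. by rewrite /frob_inner linearZ -scalemxAl mxtraceZ. Qed.

Lemma frob_innerNl {R : realType} {n p} (A C : 'M[R]_(n, p)) :
  frob_inner (- A) C = - frob_inner A C.
Proof. by rewrite -scaleN1r frob_innerZl mulN1r. Qed.

Lemma frob_inner_ge0 {R : realType} {n p} (A : 'M[R]_(n, p)) :
  0 <= frob_inner A A.
Proof.
by rewrite frob_innerE; do 2!apply: sumr_ge0 => ? _; rewrite -expr2 sqr_ge0.
Qed.

Lemma frob_norm_ge0 {R : realType} {n p} (A : 'M[R]_(n, p)) : 0 <= frob_norm A.
Proof. exact: sqrtr_ge0. Qed.

Lemma frob_norm_sqr {R : realType} {n p} (A : 'M[R]_(n, p)) :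
  frob_norm A ^+ 2 = frob_inner A A.
Proof. by rewrite sqr_sqrtr //; exact: frob_inner_ge0. Qed.

Lemma ler_frob_norm {R : realType} {n p m q} (A : 'M[R]_(n, p)) (B : 'M[R]_(m, q)) :
  (frob_norm A <= frob_norm B) = (frob_inner A A <= frob_inner B B).
Proof. by rewrite -!frob_norm_sqr ler_sqr // nnegrE frob_norm_ge0. Qed.

Lemma sum_sqr_CauchySchwarz {R : realFieldType} {I : finType} (x y : I -> R) :
  (\sum_i x i * y i) ^+ 2 <= (\sum_i x i ^+ 2) * (\sum_i y i ^+ 2).
Proof.
set c := \sum_i x i * y i; set a := \sum_i x i ^+ 2; set b := \sum_i y i ^+ 2.
have H (s t : R) : 0 <= s ^+ 2 * a - 2 * s * t * c + t ^+ 2 * b.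
  have -> : s ^+ 2 * a - 2 * s * t * c + t ^+ 2 * b =
      \sum_i (s * x i - t * y i) ^+ 2.
    rewrite !mulr_sumr -sumrB -big_split /=.
    by apply: eq_bigr => i _; ring.
  by apply: sumr_ge0 => i _; exact: sqr_ge0.
have a0 : 0 <= a by apply: sumr_ge0 => i _; exact: sqr_ge0.
(* With [s = c] and [t = a] the nonnegative quadratic form becomes [a * (a * b - c ^+ 2)]. Dividing
   by [a] fails only when every [x i] vanishes. *)
have [a_gt0|] := ltP 0 a.
  have := H c a.
  have -> : c ^+ 2 * a - 2 * c * a * c + a ^+ 2 * b = a * (a * b - c ^+ 2) by ring.
  by rewrite pmulr_rge0 // subr_ge0.
move=> a_le0; have {}a0 : a = 0 by apply/eqP; rewrite eq_le a_le0.
suff -> : c = 0 by rewrite a0 expr0n mul0r.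
apply: big1 => i _; suff -> : x i = 0 by rewrite mul0r.
apply/eqP; rewrite -sqrf_eq0; apply/eqP.
by move: a0 => /psumr_eq0P; apply=> // j _; exact: sqr_ge0.
Qed.

Lemma frob_inner_le {R : realType} {n p} (A B : 'M[R]_(n, p)) :
  frob_inner A B <= frob_norm A * frob_norm B.
Proof.
apply: (le_trans (ler_norm _)); rewrite -ler_sqr ?nnegrE ?mulr_ge0 ?frob_norm_ge0//.
rewrite real_normK ?num_real// exprMn !frob_norm_sqr !frob_innerE !pair_big /=.
have := sum_sqr_CauchySchwarz (fun k : 'I_n * 'I_p => A k.1 k.2) (fun k => B k.1 k.2).
by under [X in _ <= X * _ -> _]eq_bigr do rewrite expr2;
  under [X in _ <= _ * X -> _]eq_bigr do rewrite expr2.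
Qed.

Lemma ler_frob_normD {R : realType} {n p} (A B : 'M[R]_(n, p)) :
  frob_norm (A + B) <= frob_norm A + frob_norm B.
Proof.
rewrite -ler_sqr ?nnegrE ?addr_ge0 ?frob_norm_ge0// sqrrD !frob_norm_sqr.
rewrite frob_innerDl !(frob_innerC _ (A + B)) !frob_innerDl (frob_innerC B A).
by have := frob_inner_le A B; lra.
Qed.

Lemma frob_normZ {R : realType} {n p} a (A : 'M[R]_(n, p)) :
  frob_norm (a *: A) = `|a| * frob_norm A.
Proof.
apply/eqP; rewrite -(@eqrXn2 _ 2) ?mulr_ge0 ?frob_norm_ge0//.
rewrite exprMn !frob_norm_sqr frob_innerZl frob_innerC frob_innerZl mulrA.
by rewrite -expr2 real_normK ?num_real.
Qed.

Lemma frob_normN {R : realType} {n p} (A : 'M[R]_(n, p)) :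
  frob_norm (- A) = frob_norm A.
Proof. by rewrite -scaleN1r frob_normZ normrN1 mul1r. Qed.

Lemma frob_norm0 {R : realType} {n p} : frob_norm (0 : 'M[R]_(n, p)) = 0.
Proof. by rewrite -(scale0r (0 : 'M[R]_(n, p))) frob_normZ normr0 mul0r. Qed.

Lemma ler_frob_norm_sum {R : realType} {n p} {I : Type} (r : seq I) (P : pred I)
    (F : I -> 'M[R]_(n, p)) :
  frob_norm (\sum_(i <- r | P i) F i) <= \sum_(i <- r | P i) frob_norm (F i).
Proof.
elim/big_ind2: _ => [|A a B b hA hB|//]; first by rewrite frob_norm0.
by rewrite (le_trans (ler_frob_normD _ _))// lerD.
Qed.

Lemma ler_frob_normM {R : realType} {m n p} (A : 'M[R]_(m, n)) (B : 'M[R]_(n, p)) :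
  frob_norm (A *m B) <= frob_norm A * frob_norm B.
Proof.
rewrite -ler_sqr ?nnegrE ?mulr_ge0 ?frob_norm_ge0// exprMn !frob_norm_sqr.
rewrite !frob_innerE mulr_suml; apply: ler_sum => i _.
rewrite [X in _ * X]exchange_big mulr_sumr /=; apply: ler_sum => k _.
rewrite -expr2 mxE (le_trans (sum_sqr_CauchySchwarz _ _))//.
Qed.

Lemma frob_norm_mulmx_orthol {R : realType} {m n} (Q : 'M[R]_m) (A : 'M[R]_(m, n)) :
  orthogonal_mx Q -> frob_norm (Q *m A) = frob_norm A.
Proof.
by move=> hQ; rewrite /frob_norm trmx_mul -mulmxA (mulmxA Q^T) hQ mul1mx.
Qed.

Lemma frob_norm_tr {R : realType} {m n} (A : 'M[R]_(m, n)) :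
  frob_norm A^T = frob_norm A.
Proof. by rewrite /frob_norm trmxK mxtrace_mulC. Qed.

Lemma orthogonal_mx_tr {R : realType} {n} (Q : 'M[R]_n) :
  orthogonal_mx Q -> orthogonal_mx Q^T.
Proof. by rewrite /orthogonal_mx trmxK; exact: mulmx1C. Qed.

Lemma frob_norm_mulmx_orthor {R : realType} {m n} (A : 'M[R]_(m, n)) (Q : 'M[R]_n) :
  orthogonal_mx Q -> frob_norm (A *m Q) = frob_norm A.
Proof.
move=> hQ; rewrite -frob_norm_tr trmx_mul frob_norm_mulmx_orthol ?frob_norm_tr//.
exact: orthogonal_mx_tr.
Qed.

Lemma ler_norm_frob {R : realType} {m n} (A : 'M[R]_(m, n)) i j :
  `|A i j| <= frob_norm A.
Proof.
rewrite -ler_sqr ?nnegrE ?frob_norm_ge0// frob_norm_sqr frob_innerE.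
rewrite real_normK ?num_real// (bigD1 i) //= (bigD1 j) //= -expr2 -addrA lerDl.
by rewrite addr_ge0// !sumr_ge0// => k _; rewrite ?sumr_ge0 // => *; rewrite -expr2 sqr_ge0.
Qed.

(** The exponent 0 is left out because the identity has Frobenius norm [sqrt n]. *)
Lemma ler_frob_normX {R : realType} {n} (A : 'M[R]_n) k :
  frob_norm (A ^+ k.+1) <= frob_norm A ^+ k.+1.
Proof.
elim: k => [//|k IH]; rewrite exprS [leRHS]exprS (le_trans (ler_frob_normM _ _))//.
by rewrite ler_wpM2l ?frob_norm_ge0.
Qed.

Lemma cvg_mxP {R : realType} {T : Type} {F : set_system T} {FF : Filter F} {m n}
    (u : T -> 'M[R]_(m, n)) (l : 'M[R]_(m, n)) :
  (u @ F --> l) <-> (forall i j, (fun t => u t i j) @ F --> l i j).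
Proof.
split=> [ul i j|ul].
  exact: (@cvg_comp _ _ _ u (fun M : 'M[R]_(m, n) => M i j) _ _ _ ul
            (@coord_continuous R m n i j l)).
apply/cvgrPdist_le => /= e e0; near=> x.
rewrite /Num.Def.normr/= mx_normrE (bigmax_le _ (ltW e0))//= => i _.
rewrite !mxE/=; move: i; near: x; apply: filter_forall => /= i.
exact: ((cvgrPdist_le _ _).1 (ul i.1 i.2)).
Unshelve. all: by end_near. Qed.

(** * Matrix exponential *)

Lemma cvg_sum {R : realType} {T I : Type} {F : set_system T} {FF : Filter F}
    (r : seq I) (f : I -> T -> R) (l : I -> R) :
  (forall i, f i @ F --> l i) ->
  (fun t => \sum_(i <- r) f i t) @ F --> \sum_(i <- r) l i.
Proof. by move=> fl; apply: cvg_big => // -[x y]; exact: add_continuous. Qed.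

Lemma cvg_mulmx {R : realType} {T : Type} {F : set_system T} {FF : Filter F} {m n p}
    (u : T -> 'M[R]_(m, n)) (v : T -> 'M[R]_(n, p))
    (l : 'M[R]_(m, n)) (k : 'M[R]_(n, p)) :
  u @ F --> l -> v @ F --> k -> (fun t => u t *m v t) @ F --> l *m k.
Proof.
move=> /cvg_mxP ul /cvg_mxP vk; apply/cvg_mxP => i j.
rewrite mxE; under eq_fun do rewrite mxE.
by apply: cvg_sum => h; apply: cvgM.
Qed.

Lemma cvg_frob_inner {R : realType} {T : Type} {F : set_system T} {FF : Filter F}
    {m n} (u v : T -> 'M[R]_(m, n)) (l k : 'M[R]_(m, n)) :
  u @ F --> l -> v @ F --> k ->
  (fun t => frob_inner (u t) (v t)) @ F --> frob_inner l k.
Proof.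
move=> /cvg_mxP ul /cvg_mxP vk; rewrite frob_innerE.
under eq_fun do rewrite frob_innerE.
by apply: cvg_sum => i; apply: cvg_sum => j; apply: cvgM.
Qed.

Lemma cvg_frob_norm {R : realType} {T : Type} {F : set_system T} {FF : Filter F}
    {m n} (u : T -> 'M[R]_(m, n)) (l : 'M[R]_(m, n)) :
  u @ F --> l -> (fun t => frob_norm (u t)) @ F --> frob_norm l.
Proof.
move=> ul; apply: (@cvg_comp _ _ _ (fun t => frob_inner (u t) (u t)) Num.sqrt _ _ _
  (cvg_frob_inner _ _ _ _ ul ul)).
exact: sqrt_continuous.
Qed.

(** Entrywise the exponent 0 is harmless, the entries of the identity being 0 or 1; so every term of
    the exponential series is dominated by the scalar one. *)
Lemma normr_mx_expr_le {R : realType} {n} (A : 'M[R]_n) k i j :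
  `|(A ^+ k) i j| <= frob_norm A ^+ k.
Proof.
case: k => [|k]; last exact: le_trans (ler_norm_frob _ _ _) (ler_frob_normX _ _).
by rewrite !expr0 mxE; case: (i == j); rewrite ?normr1 ?normr0.
Qed.

Lemma series_mxE {R : realType} {m n} (u : nat -> 'M[R]_(m, n)) N i j :
  series u N i j = series (fun k => u k i j) N.
Proof. by rewrite /series /= summxE. Qed.

(** [exp_mx] is a [limn], which carries information only once convergence is known: each entry
    converges absolutely by comparison with the scalar series at [frob_norm A]. *)
Lemma cvg_exp_mx {R : realType} {n} (A : 'M[R]_n) :
  series (fun k : nat => (k`!%:R^-1 : R) *: A ^+ k) @ \oo --> exp_mx A.
Proof.
suff H : forall i j, cvgn (series (fun k : nat => ((k`!%:R^-1 : R) *: A ^+ k) i j)).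
  rewrite /exp_mx; set u := series _; suff : cvgn u by [].
  apply/cvg_ex; exists (\matrix_(i, j) limn (fun N => u N i j)).
  apply/cvg_mxP => i j; rewrite mxE; under eq_fun do rewrite series_mxE.
  exact: H.
move=> i j; apply: normed_cvg.
apply: (@series_le_cvg _ _ (exp_coeff (frob_norm A))).
- by move=> k; exact: normr_ge0.
- by move=> k; rewrite /exp_coeff /= mulr_ge0 ?exprn_ge0 ?frob_norm_ge0.
- move=> k; rewrite /exp_coeff /= mxE normrM [`|_%:R^-1|]ger0_norm ?invr_ge0// [leLHS]mulrC.
  by rewrite ler_wpM2r ?normr_mx_expr_le.
- exact: is_cvg_series_exp_coeff.
Qed.

Lemma exp_mx_eq {R : realType} {n} (A E : 'M[R]_n) :
  (forall i j, series (fun k : nat => k`!%:R^-1 * (A ^+ k) i j) @ \oo --> E i j) ->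
  exp_mx A = E.
Proof.
move=> H; apply/esym/(@cvg_unique _ _ (series (fun k : nat => (k`!%:R^-1 : R) *: A ^+ k) @ \oo)).
- exact: norm_hausdorff.
- apply/cvg_mxP => i j; under eq_fun do rewrite series_mxE.
  by under eq_fun do (under eq_fun do rewrite mxE); exact: H.
- exact: cvg_exp_mx.
Qed.

(** A rectangular [C] covers three uses at once: conjugation, commutation of a matrix with its
    exponential, and restriction to an invariant subspace spanned by the rows of [C]. *)
Lemma exp_mx_intertwine {R : realType} {m n} (C : 'M[R]_(m, n)) Z L :
  C *m Z = L *m C -> C *m exp_mx Z = exp_mx L *m C.
Proof.
move=> CZ; pose u N := C *m series (fun k : nat => (k`!%:R^-1 : R) *: Z ^+ k) N.
apply: (@cvg_unique _ _ (u @ \oo)).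
- exact: norm_hausdorff.
- by apply: cvg_mulmx; [exact: cvg_cst | exact: cvg_exp_mx].
- have -> : u = fun N => series (fun k : nat => (k`!%:R^-1 : R) *: L ^+ k) N *m C.
    apply/funext => N; rewrite /u /series /= mulmx_sumr mulmx_suml.
    apply: eq_bigr => k _; rewrite -scalemxAr -scalemxAl; congr (_ *: _).
    elim: k => [|k IH]; first by rewrite !expr0 mulmx1 mul1mx.
    rewrite !exprS -[Z * _]/(Z *m _) -[L * _]/(L *m _).
    by rewrite mulmxA CZ -mulmxA IH mulmxA.
  by apply: cvg_mulmx; [exact: cvg_exp_mx | exact: cvg_cst].
Qed.

Lemma trmx_expr {R : realType} {n} (A : 'M[R]_n) k : (A ^+ k)^T = A^T ^+ k.
Proof.
elim: k => [|k IH]; first by rewrite !expr0 trmx1.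
by rewrite exprS exprSr -[A * _]/(A *m _) trmx_mul IH.
Qed.

Lemma exp_mx_tr {R : realType} {n} (A : 'M[R]_n) : exp_mx A^T = (exp_mx A)^T.
Proof.
apply: exp_mx_eq => i j; rewrite mxE.
have /cvg_mxP/(_ j i) := cvg_exp_mx A.
under eq_fun do rewrite series_mxE.
suff -> : (fun k : nat => k`!%:R^-1 * (A^T ^+ k) i j) =
    (fun k : nat => ((k`!%:R^-1 : R) *: A ^+ k) j i) by [].
by apply/funext => k; rewrite -trmx_expr !mxE.
Qed.

Lemma exp_mx_scalar {R : realType} {n} (x : R) :
  exp_mx (x%:M : 'M[R]_n) = (expR x)%:M.
Proof.
apply: exp_mx_eq => i j; rewrite mxE.
have -> : (fun k : nat => k`!%:R^-1 * ((x%:M : 'M[R]_n) ^+ k) i j) =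
    (fun k : nat => exp_coeff x k * (i == j)%:R).
  apply/funext => k; rewrite /exp_coeff /=.
  have -> : (x%:M : 'M[R]_n) ^+ k = (x ^+ k)%:M.
    elim: k => [|k IH]; first by rewrite !expr0.
    by rewrite !exprS IH -[_ * _]/(_ *m _) -scalar_mxM.
  by rewrite mxE mulr_natr mulrnAr mulrC.
rewrite -[X in _ --> X]mulr_natr [X in X @ _ --> _](_ : _ =
    (fun N => series (exp_coeff x) N * (i == j)%:R)); last first.
  by apply/funext => N; rewrite /series /= mulr_suml.
by apply: cvgMl; exact: is_cvg_series_exp_coeff.
Qed.

(* The defect of [exp(x) exp(y) = exp(x + y)] for the partial sums is the sum of
   the same terms of the Cauchy product for [x], [y] scalars and for matrices;
   so the matrix case is dominated by the scalar one. *)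
Lemma exp_partial_sumD {R : realType} {V : algType R} (x y : V) N :
  x * y = y * x ->
  (\sum_(0 <= k < N) (k`!%:R^-1 : R) *: x ^+ k) *
    (\sum_(0 <= k < N) (k`!%:R^-1 : R) *: y ^+ k) -
  \sum_(0 <= k < N) (k`!%:R^-1 : R) *: (x + y) ^+ k =
  \sum_(0 <= i < N) \sum_(N - i <= j < N)
     ((i`!%:R^-1 : R) *: x ^+ i) * ((j`!%:R^-1 : R) *: y ^+ j).
Proof.
move=> xy; pose F i j := ((i`!%:R^-1 : R) *: x ^+ i) * ((j`!%:R^-1 : R) *: y ^+ j).
have -> : \sum_(0 <= k < N) (k`!%:R^-1 : R) *: (x + y) ^+ k =
    \sum_(0 <= i < N) \sum_(0 <= j < N - i) F i j.
  elim: N => [|N IH]; first by rewrite !big_geq.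
  rewrite [LHS]big_nat_recr //= IH [RHS]big_nat_recr //= subSnn big_nat1.
  under [in RHS]eq_big_nat => i /andP[_ iN].
    rewrite subSn ?(ltnW iN)// big_nat_recr //=; over.
  rewrite big_split /= -addrA; congr (_ + _).
  have -> : (\sum_(0 <= i < N) F i (N - i)%N + F N 0%N) =
     \sum_(0 <= i < N.+1) F i (N - i)%N by rewrite big_nat_recr //= subnn.
  rewrite exprDn_comm; last by rewrite /GRing.comm.
  rewrite scaler_sumr [RHS]big_nat_rev /= add0n big_mkord; apply: eq_bigr => i _.
  rewrite /F subSS subKn ?leq_ord// -scalerAl -scalerAr scalerA.
  rewrite -[_ *+ 'C(_, _)]scaler_nat scalerA; congr (_ *: _).
  rewrite -(bin_fact (leq_ord i)) !natrM.
  field; rewrite !pnatr_eq0 -!lt0n !fact_gt0 bin_gt0 leq_ord //.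
rewrite mulr_suml -sumrB; apply: eq_big_nat => i /andP[_ iN].
rewrite mulr_sumr (big_cat_nat (n := (N - i)%N)) //= ?leq_subr//.
by rewrite /F addrAC subrr add0r.
Qed.

Lemma normr_mx_exprM_le {R : realType} {n} (A B : 'M[R]_n) i j k l :
  `|(A ^+ i * B ^+ j) k l| <= frob_norm A ^+ i * frob_norm B ^+ j.
Proof.
case: i => [|i]; first by rewrite !expr0 !mul1r normr_mx_expr_le.
case: j => [|j]; first by rewrite !expr0 !mulr1 normr_mx_expr_le.
apply: (le_trans (ler_norm_frob _ _ _)); apply: (le_trans (ler_frob_normM _ _)).
by rewrite ler_pM ?frob_norm_ge0 ?ler_frob_normX.
Qed.

Lemma exp_mxD {R : realType} {n} (A B : 'M[R]_n) :
  A *m B = B *m A -> exp_mx (A + B) = exp_mx A *m exp_mx B.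
Proof.
case: n A B => [|n] A B AB; first by apply/matrixP => -[].
pose S (C : 'M[R]_n.+1) := series (fun k : nat => (k`!%:R^-1 : R) *: C ^+ k).
pose a := frob_norm A; pose b := frob_norm B.
pose w N := series (exp_coeff a) N * series (exp_coeff b) N - series (exp_coeff (a + b)) N.
have w0 : w @ \oo --> (0 : R).
  rewrite -(subrr (expR (a + b))) [X in _ --> X - _]expRD.
  by apply: cvgB; [apply: cvgM|]; exact: is_cvg_series_exp_coeff.
pose u N := S A N *m S B N - S (A + B) N.
have ul : u @ \oo --> exp_mx A *m exp_mx B - exp_mx (A + B).
  by apply: cvgB; [apply: cvg_mulmx|]; exact: cvg_exp_mx.
have uw N i j : `|u N i j| <= w N.
  have -> : w N = \sum_(0 <= k < N) \sum_(N - k <= h < N)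
      (k`!%:R^-1 * a ^+ k) * (h`!%:R^-1 * b ^+ h).
    rewrite -(exp_partial_sumD (V := R^o) a b N (mulrC a b)) /w /series /=.
    congr (_ * _ - _); apply: eq_bigr => k _; rewrite /exp_coeff /=; exact: mulrC.
  rewrite /u /S /series /= -[_ *m _]/(_ * _) exp_partial_sumD // summxE.
  apply: (le_trans (ler_norm_sum _ _ _)); apply: ler_sum => k _.
  rewrite summxE; apply: (le_trans (ler_norm_sum _ _ _)); apply: ler_sum => h _.
  rewrite -scalerAl -scalerAr scalerA mxE normrM mulrACA ger0_norm; last first.
    by rewrite mulr_ge0.
  by rewrite ler_wpM2l ?mulr_ge0 ?normr_mx_exprM_le.
suff : exp_mx A *m exp_mx B - exp_mx (A + B) = 0.
  by move=> /eqP; rewrite subr_eq0 => /eqP.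
apply: (@cvg_unique _ _ (u @ \oo)); [exact: norm_hausdorff|exact: ul|].
apply/cvg_mxP => i j; rewrite mxE.
apply: norm_cvg0; apply: (@squeeze_cvgr _ _ _ _ (fun=> 0) w) => //; last exact: cvg_cst.
by apply: nearW => N; rewrite normr_ge0 uw.
Qed.

Lemma exp_mx0 {R : realType} {n} : exp_mx (0 : 'M[R]_n) = 1%:M.
Proof.
have -> : (0 : 'M[R]_n) = 0%:M by apply/matrixP => i j; rewrite !mxE mul0rn.
by rewrite exp_mx_scalar expR0.
Qed.

Lemma exp_mxNK {R : realType} {n} (A : 'M[R]_n) : exp_mx (- A) *m exp_mx A = 1%:M.
Proof. by rewrite -exp_mxD ?addNr ?exp_mx0// mulNmx mulmxN. Qed.

Lemma exp_mx_natmul {R : realType} {n} (A : 'M[R]_n) N :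
  exp_mx (A *+ N) = exp_mx A ^+ N.
Proof.
elim: N => [|N IH]; first by rewrite mulr0n exp_mx0 expr0.
rewrite mulrS exprS exp_mxD ?IH//.
elim: N {IH} => [|N IH]; first by rewrite mulr0n mulmx0 mul0mx.
by rewrite mulrS mulmxDl mulmxDr IH.
Qed.

Lemma exp_mx_skew {R : realType} {n} (A : 'M[R]_n) :
  A^T = - A -> orthogonal_mx (exp_mx A).
Proof. by move=> hA; rewrite /orthogonal_mx -exp_mx_tr hA exp_mxNK. Qed.

(** Only powers of exponent at least 2 remain, so the series can be compared term by term in norm,
    with a bound independent of the size [n]. *)
Lemma frob_exp_mx_rem {R : realType} {n} (A : 'M[R]_n) :
  frob_norm (exp_mx A - (1%:M + A)) <= expR (frob_norm A) - (1 + frob_norm A).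
Proof.
set a := frob_norm A.
pose S := series (fun k : nat => (k`!%:R^-1 : R) *: A ^+ k).
have SE N : S N.+2 - (1%:M + A) = \sum_(0 <= k < N) (k.+2`!%:R^-1 : R) *: A ^+ k.+2.
  rewrite /S /series /= big_nat_recl // big_nat_recl //= expr0 expr1 !invr1 !scale1r.
  by rewrite addrA [X in X - _]addrC addrK.
have sE N : series (exp_coeff a) N.+2 - (1 + a) =
    \sum_(0 <= k < N) k.+2`!%:R^-1 * a ^+ k.+2.
  rewrite /series /= big_nat_recl // big_nat_recl //= /exp_coeff /= expr0 expr1 !divr1.
  by rewrite addrA [X in X - _]addrC addrK; apply: eq_bigr => k _; rewrite mulrC.
have uS : (fun N => frob_norm (S N - (1%:M + A))) @ \oo -->
    frob_norm (exp_mx A - (1%:M + A)).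
  by apply: cvg_frob_norm; apply: cvgB; [exact: cvg_exp_mx | exact: cvg_cst].
have us : (fun N => series (exp_coeff a) N - (1 + a)) @ \oo --> expR a - (1 + a).
  by apply: cvgB; [exact: is_cvg_series_exp_coeff | exact: cvg_cst].
rewrite -(cvg_lim _ uS)// -(cvg_lim _ us)//.
apply: ler_lim; [by apply/cvg_ex; eexists; exact: uS | by apply/cvg_ex; eexists; exact: us|].
near=> N.
have -> : N = (N - 2)%N.+2 by rewrite -addn2 subnK //; near: N; exists 2%N.
rewrite SE sE (le_trans (ler_frob_norm_sum _ _ _))//; apply: ler_sum => k _.
by rewrite frob_normZ ger0_norm ?invr_ge0// ler_wpM2l ?invr_ge0// ler_frob_normX.
Unshelve. all: by end_near. Qed.

(** From [1 - x <= expR (- x)] one gets [expR x <= 1 / (1 - x)], whose remainder is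
    [x ^+ 2 / (1 - x)]. *)
Lemma expR_rem_le {R : realType} (x : R) :
  0 <= x <= 2^-1 -> expR x - (1 + x) <= 2 * x ^+ 2.
Proof.
move=> /andP[x0 x2].
have h : expR x <= (1 - x)^-1.
  rewrite -[leLHS]invrK -expRN lef_pV2 ?posrE ?expR_gt0 ?subr_gt0 //; last by lra.
  exact: expR_ge1Dx.
rewrite lerBlDr (le_trans h)// -[leLHS]mul1r ler_pdivrMr; last by lra.
by nra.
Qed.

Lemma ler_frob_normXB {R : realType} {n} (P Q : 'M[R]_n) N :
  orthogonal_mx P -> orthogonal_mx Q ->
  frob_norm (P ^+ N - Q ^+ N) <= N%:R * frob_norm (P - Q).
Proof.
move=> hP hQ; elim: N => [|N IH]; first by rewrite !expr0 subrr frob_norm0 mul0r.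
have hQN : orthogonal_mx (Q ^+ N).
  elim: N {IH} => [|N IH]; first by rewrite expr0 /orthogonal_mx trmx1 mul1mx.
  by rewrite exprS /orthogonal_mx trmx_mul -mulmxA (mulmxA Q^T) hQ mul1mx.
have -> : P ^+ N.+1 - Q ^+ N.+1 = P *m (P ^+ N - Q ^+ N) + (P - Q) *m Q ^+ N.
  by rewrite mulmxBr mulmxBl !exprS addrA subrK.
rewrite (le_trans (ler_frob_normD _ _))// frob_norm_mulmx_orthol//.
by rewrite frob_norm_mulmx_orthor// -[N.+1]addn1 natrD mulrDl mul1r lerD.
Qed.

(* Telescoping [exp(A) = exp(A / N)^N] reduces the claim to the first order
   expansion of [exp] at [0], as the powers involved are isometries. *)
Lemma exp_mx_skew_lipschitz {R : realType} {n} (A B : 'M[R]_n) :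
  A^T = - A -> B^T = - B -> frob_norm (exp_mx A - exp_mx B) <= frob_norm (A - B).
Proof.
move=> hA hB; apply/ler_addgt0Pr => e e0.
set a := frob_norm A; set b := frob_norm B.
have a0 : 0 <= a := frob_norm_ge0 A.
have b0 : 0 <= b := frob_norm_ge0 B.
near \oo => N.
have N1 : (0 < N%:R :> R) by rewrite ltr0n; near: N; exists 1%N.
(* The bounds [Na] and [Nb] bring [A / N] and [B / N] into the range of [expR_rem_le]; [Ne] makes
   the accumulated second order error, [(2 a^2 + 2 b^2) / N], at most [e]. *)
have Na : a * 2 <= N%:R by near: N; exact: nbhs_infty_ger.
have Nb : b * 2 <= N%:R by near: N; exact: nbhs_infty_ger.
have Ne : (2 * a ^+ 2 + 2 * b ^+ 2) / e <= N%:R by near: N; exact: nbhs_infty_ger.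
pose c : R := N%:R^-1.
have c0 : 0 < c by rewrite invr_gt0.
have cN : c * N%:R = 1 by rewrite mulVf ?gt_eqF.
have cX (X : 'M[R]_n) : exp_mx X = exp_mx (c *: X) ^+ N.
  by rewrite -exp_mx_natmul -scaler_nat scalerA mulrC cN scale1r.
have skc (X : 'M[R]_n) : X^T = - X -> orthogonal_mx (exp_mx (c *: X)).
  by move=> hX; apply: exp_mx_skew; rewrite linearZ /= hX scalerN.
have rem (X : 'M[R]_n) : frob_norm X * 2 <= N%:R ->
    N%:R * frob_norm (exp_mx (c *: X) - (1%:M + c *: X)) <= 2 * frob_norm X ^+ 2 * c.
  move=> hX; have x0 := frob_norm_ge0 X.
  have h := frob_exp_mx_rem (c *: X); rewrite frob_normZ (gtr0_norm c0) in h.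
  have := @expR_rem_le R (c * frob_norm X).
  have -> : 0 <= c * frob_norm X <= 2^-1.
    rewrite mulr_ge0 ?(ltW c0)//= /c mulrC ler_pdivrMr //; lra.
  move=> /(_ isT) h2; apply: (le_trans (ler_wpM2l (ltW N1) (le_trans h h2))).
  have -> : N%:R * (2 * (c * frob_norm X) ^+ 2) = c * N%:R * (2 * frob_norm X ^+ 2 * c).
    by ring.
  by rewrite cN mul1r.
rewrite (cX A) (cX B) (le_trans (ler_frob_normXB _ _ _ (skc _ hA) (skc _ hB)))//.
have -> : exp_mx (c *: A) - exp_mx (c *: B) = c *: (A - B) +
    ((exp_mx (c *: A) - (1%:M + c *: A)) - (exp_mx (c *: B) - (1%:M + c *: B))).
  by rewrite scalerBr; apply/matrixP => i j; rewrite !mxE; ring.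
apply: (le_trans (ler_wpM2l (ltW N1) (ler_frob_normD _ _))).
rewrite frob_normZ (gtr0_norm c0) mulrDr mulrA (mulrC _ c) cN mul1r lerD2l.
apply: (le_trans (ler_wpM2l (ltW N1) (ler_frob_normD _ _))).
rewrite frob_normN mulrDr (le_trans (lerD (rem _ Na) (rem _ Nb)))//.
by rewrite -mulrDl /c ler_pdivrMr // [leRHS]mulrC -ler_pdivrMr.
Unshelve. all: by end_near. Qed.

(** * Real spectral theorem *)

(** [a] and [b] are the real and imaginary parts of a complex row eigenvector; later arguments about
    complex eigenvalues thus stay with real matrices. *)
Lemma eigenvalue_real_pair {R : realType} {n} (A : 'M[R]_n) (z : R[i]) :
  eigenvalue (map_mx (real_complex R) A) z ->
  exists a b : 'rV[R]_n, [/\ (a != 0) || (b != 0),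
    a *m A = complex.Re z *: a - complex.Im z *: b &
    b *m A = complex.Im z *: a + complex.Re z *: b].
Proof.
move=> /eigenvalueP[v vA v0].
exists (map_mx (@complex.Re R) v), (map_mx (@complex.Im R) v).
have ReD : {morph @complex.Re R : x y / x + y >-> x + y} by move=> [? ?] [? ?].
have ImD : {morph @complex.Im R : x y / x + y >-> x + y} by move=> [? ?] [? ?].
split.
- apply: contraNT v0; rewrite negb_or !negbK => /andP[/eqP a0 /eqP b0].
  apply/eqP/rowP => j; rewrite mxE; apply/eqP; rewrite eq_complex.
  by have /rowP/(_ j) := a0; have /rowP/(_ j) := b0; rewrite !mxE => -> ->; rewrite !eqxx.
- apply/rowP => j; have /rowP/(_ j)/(congr1 (@complex.Re R)) := vA.
  rewrite !mxE (big_morph _ ReD (erefl _)) => e.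
  rewrite (eq_bigr (fun k => complex.Re (v 0 k * map_mx (real_complex R) A k j))).
    by rewrite e; case: (z) (v 0 j) => [? ?] [? ?].
  by move=> k _; rewrite !mxE; case: (v 0 k) => r s /=; rewrite mulr0 subr0.
- apply/rowP => j; have /rowP/(_ j)/(congr1 (@complex.Im R)) := vA.
  rewrite !mxE (big_morph _ ImD (erefl _)) => e.
  rewrite (eq_bigr (fun k => complex.Im (v 0 k * map_mx (real_complex R) A k j))).
    by rewrite e; case: (z) (v 0 j) => [? ?] [? ?] /=; rewrite addrC.
  by move=> k _; rewrite !mxE; case: (v 0 k) => r s /=; rewrite mulr0 add0r.
Qed.

Lemma rv_sqr_gt0 {R : realType} {n} (a : 'rV[R]_n) :
  (0 < (a *m a^T) 0 0) = (a != 0).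
Proof.
have E : (a *m a^T) 0 0 = \sum_i a 0 i ^+ 2.
  by rewrite mxE; apply: eq_bigr => i _; rewrite mxE -expr2.
rewrite lt_neqAle E sumr_ge0 ?andbT; last by move=> i _; exact: sqr_ge0.
apply/idP/idP; apply: contraNN => /eqP.
  by move=> ->; rewrite eq_sym big1 // => i _; rewrite mxE expr0n.
move=> /esym/psumr_eq0P H; apply/eqP/rowP => i; rewrite mxE.
by apply/eqP; rewrite -sqrf_eq0 H // => j _; exact: sqr_ge0.
Qed.

Lemma sym_mx_unit_eigenvector {R : realType} {n} (S : 'M[R]_n.+1) :
  S^T = S -> exists (x : R) (w : 'rV[R]_n.+1), w *m S = x *: w /\ w *m w^T = 1%:M.
Proof.
move=> hS; have [z /eigenvalue_real_pair[a [b [ab0 aS bS]]]] :=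
  @eigenvalue_closed R[i] n.+1 (map_mx (real_complex R) S) isT.
set x := complex.Re z in aS bS; set y := complex.Im z in aS bS.
(* By symmetry [a S b^T] and [b S a^T] agree; expanding both with the eigenvector equations leaves
   [y (|a|^2 + |b|^2) = 0]. *)
have y0 : y = 0.
  have E : (a *m S *m b^T) 0 0 = (b *m S *m a^T) 0 0.
    have -> : b *m S *m a^T = (a *m S *m b^T)^T.
      by rewrite !trmx_mul trmxK hS mulmxA.
    by rewrite [RHS]mxE.
  have : y * ((a *m a^T) 0 0 + (b *m b^T) 0 0) = 0.
    have C : (a *m b^T) 0 0 = (b *m a^T) 0 0.
      have -> : b *m a^T = (a *m b^T)^T by rewrite trmx_mul trmxK.
      by rewrite [RHS]mxE.
    have eD (M N : 'M[R]_1) : (M + N) 0 0 = M 0 0 + N 0 0 by rewrite mxE.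
    have eN (M : 'M[R]_1) : (- M) 0 0 = - M 0 0 by rewrite mxE.
    have eZ r (M : 'M[R]_1) : (r *: M) 0 0 = r * M 0 0 by rewrite mxE.
    move: E; rewrite aS bS mulmxBl mulmxDl -!scalemxAl !eD eN !eZ C => E.
    by lra.
  move/eqP; rewrite mulf_eq0 => /orP[/eqP//|].
  have [a0 b0] : 0 <= (a *m a^T) 0 0 /\ 0 <= (b *m b^T) 0 0.
    by split; rewrite mxE sumr_ge0// => i _; rewrite mxE -expr2 sqr_ge0.
  rewrite paddr_eq0// => /andP[/eqP a1 /eqP b1].
  by move: ab0; rewrite -!rv_sqr_gt0 a1 b1 ltxx.
have [w w0 wS] : exists2 w : 'rV[R]_n.+1, w != 0 & w *m S = x *: w.
  case/orP: ab0 => h; [exists a|exists b] => //; rewrite ?aS ?bS y0 scale0r ?subr0 ?add0r//.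
pose c := (w *m w^T) 0 0; have c0 : 0 < c by rewrite rv_sqr_gt0.
exists x, ((Num.sqrt c)^-1 *: w); split.
  by rewrite -scalemxAl wS !scalerA mulrC.
rewrite linearZ /= -scalemxAl -scalemxAr scalerA [w *m _]mx11_scalar -/c -invfM.
by rewrite -expr2 sqr_sqrtr ?(ltW c0)// scale_scalar_mx mulVf ?gt_eqF.
Qed.

(** Reflection in the hyperplane orthogonal to [u = w - e]. As [w] and [e] are unit vectors,
    [|u|^2 = 2 (1 - <w, e>) = 2 <w, u>], so [w] is sent to [w - u = e]. *)
Lemma householder {R : realType} {n} (w e : 'rV[R]_n) :
  w *m w^T = 1%:M -> e *m e^T = 1%:M ->
  exists H : 'M[R]_n, [/\ H^T = H, H *m H = 1%:M & w *m H = e].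
Proof.
move=> ww ee; have [u uE] : exists u, u = w - e by eexists.
have [u0|u0] := eqVneq u 0.
  exists 1%:M; split; rewrite ?trmx1 ?mulmx1//.
  by apply/eqP; rewrite -subr_eq0 -uE u0.
pose s := (u *m u^T) 0 0; have s0 : s != 0 by rewrite lt0r_neq0// rv_sqr_gt0.
have uu : u *m u^T = s%:M by exact: mx11_scalar.
pose t := (w *m e^T) 0 0.
have we : w *m e^T = t%:M by exact: mx11_scalar.
have ew : e *m w^T = t%:M by rewrite -[LHS]trmxK trmx_mul trmxK we tr_scalar_mx.
have sE : s = 2 - 2 * t.
  have : u *m u^T = (2 - 2 * t)%:M.
    rewrite uE linearB /= mulmxBr !mulmxBl ww ee we ew -!raddfB /=.
    by congr (_%:M); ring.
  by rewrite uu => /matrixP/(_ 0 0); rewrite !mxE !eqxx !mulr1n.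
exists (1%:M - (2 / s) *: (u^T *m u)); split.
- by rewrite linearB /= linearZ /= trmx1 trmx_mul trmxK.
- rewrite mulmxBl mul1mx mulmxBr mulmx1 -scalemxAl -scalemxAr scalerA.
  rewrite -mulmxA (mulmxA u) uu mul_scalar_mx -scalemxAr scalerA opprB.
  rewrite [X in X *: _ - _](_ : _ = 2 / s + 2 / s); last by field.
  by rewrite scalerDl addrK subrK.
- rewrite mulmxBr mulmx1 -scalemxAr mulmxA.
  have -> : w *m u^T = (1 - t)%:M by rewrite uE linearB /= mulmxBr ww we -raddfB.
  rewrite mul_scalar_mx scalerA [X in X *: _](_ : _ = 1); first by rewrite scale1r uE subKr.
  by move: s0; rewrite sE => s0; field.
Qed.

(* Induction on the dimension: a Householder reflection sends a unit eigenvector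
   to the first basis vector and splits off a block of size one. *)
Lemma real_spectral {R : realType} {n} (S : 'M[R]_n) : S^T = S ->
  exists (W : 'M[R]_n) (d : 'rV[R]_n), orthogonal_mx W /\ S = W^T *m diag_mx d *m W.
Proof.
elim: n S => [|n IH] S hS.
  exists 1%:M, 0; split; first by rewrite /orthogonal_mx trmx1 mul1mx.
  by apply/matrixP => -[].
have [x [w [wS ww]]] := sym_mx_unit_eigenvector S hS.
pose e : 'rV[R]_(1 + n) := row_mx 1%:M 0.
have ee : e *m e^T = 1%:M by rewrite tr_row_mx mul_row_col mul0mx addr0 trmx1 mulmx1.
have [H [HT HH wH]] := householder w e ww ee.
have eH : e *m H = w by rewrite -wH -mulmxA HH mulmx1.
pose T : 'M[R]_(1 + n) := H *m S *m H.
have TT : T^T = T by rewrite /T !trmx_mul HT hS mulmxA.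
have eT : e *m T = x *: e by rewrite /T !mulmxA eH wS -scalemxAl wH.
have TE : T = block_mx x%:M 0 0 (drsubmx T).
  have := eT; rewrite -{1}(submxK T) /e mul_row_block !mul1mx !mul0mx !addr0.
  rewrite scale_row_mx scaler0 => /eq_row_mx[ul ur].
  rewrite -{1}(submxK T) ul ur; congr (block_mx _ _ _ _).
    by rewrite scalemx1.
  have := congr1 (@dlsubmx _ 1 n 1 n) TT; rewrite -{1}(submxK T) tr_block_mx block_mxKdl.
  rewrite ur trmx0 => h.
exact: esym h.
have T'T : (drsubmx T)^T = drsubmx T by rewrite trmx_drsub TT.
have [W' [d' [hW' S'E]]] := IH _ T'T.
pose B : 'M[R]_(1 + n) := block_mx 1%:M 0 0 W'.
exists (B *m H), (row_mx x%:M d'); split.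
  rewrite /orthogonal_mx trmx_mul mulmxA -(mulmxA _ B^T) HT.
  rewrite tr_block_mx mulmx_block !trmx0 !mul0mx !mulmx0 !addr0 !add0r hW' trmx1 mulmx1.
  by rewrite -scalar_mx_block mulmx1.
have -> : (B *m H)^T *m diag_mx (row_mx x%:M d') *m (B *m H) =
    H *m (B^T *m diag_mx (row_mx x%:M d') *m B) *m H.
  by rewrite trmx_mul HT !mulmxA.
have -> : B^T *m diag_mx (row_mx x%:M d') *m B = T.
  rewrite diag_mx_row tr_block_mx !mulmx_block !trmx0 !mul0mx !mulmx0 !addr0 !add0r.
  rewrite ?mulmx0 ?mul0mx ?addr0 ?add0r trmx1 mulmx1 mul1mx -S'E [RHS]TE.
  congr (block_mx _ _ _ _); apply/matrixP => i j; rewrite !mxE !ord1 eqxx.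
  by rewrite mulr1n.
by rewrite /T !mulmxA HH mul1mx -mulmxA HH mulmx1.
Qed.

(** * Positive semidefinite matrices *)

Lemma psd_mx_congr {R : realType} {m n} (K : 'M[R]_m) (M : 'M[R]_(m, n)) :
  psd_mx K -> psd_mx (M^T *m K *m M).
Proof.
move=> [KT K0]; split; first by rewrite !trmx_mul trmxK KT mulmxA.
by move=> x; have := K0 (M *m x); rewrite trmx_mul !mulmxA.
Qed.

Lemma psd_mxD {R : realType} {n} (K L : 'M[R]_n) :
  psd_mx K -> psd_mx L -> psd_mx (K + L).
Proof.
move=> [KT K0] [LT L0]; split; first by rewrite linearD /= KT LT.
by move=> x; rewrite mulmxDr mulmxDl mxE addr_ge0.
Qed.

Lemma psd_mx_diag {R : realType} {n} (d : 'rV[R]_n) :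
  (forall j, 0 <= d 0 j) -> psd_mx (diag_mx d).
Proof.
move=> d0; split; first by rewrite tr_diag_mx.
move=> x; rewrite mul_mx_diag mxE sumr_ge0 // => j _.
by rewrite !mxE mulrAC mulr_ge0 // -expr2 sqr_ge0.
Qed.

Lemma psd_mx_gram {R : realType} {m n} (M : 'M[R]_(m, n)) : psd_mx (M^T *m M).
Proof.
rewrite -[M^T]mulmx1 -diag_const_mx; apply: psd_mx_congr; apply: psd_mx_diag.
by move=> j; rewrite mxE.
Qed.

Lemma psd_spectral_ge0 {R : realType} {n} (W : 'M[R]_n) (d : 'rV[R]_n) :
  orthogonal_mx W -> psd_mx (W^T *m diag_mx d *m W) -> forall j, 0 <= d 0 j.
Proof.
move=> hW [_ H] j; move: (H (W^T *m delta_mx j 0)).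
have WW : W *m W^T = 1%:M by apply: mulmx1C.
rewrite trmx_mul trmxK trmx_delta !mulmxA -(mulmxA (delta_mx _ _)) WW mulmx1.
rewrite -(mulmxA _ W) WW mulmx1 -rowE -colE !mxE.
by rewrite eqxx mulr1n.
Qed.

Lemma sqrt_mxP {R : realType} {n} (A : 'M[R]_n) : psd_mx A ->
  psd_mx (sqrt_mx A) /\ sqrt_mx A *m sqrt_mx A = A.
Proof.
move=> hA; have [W [d [hW AE]]] := real_spectral A (proj1 hA).
have d0 := psd_spectral_ge0 W d hW; rewrite -AE in d0; have {}d0 := d0 hA.
suff : exists P, psd_mx P /\ P *m P = A.
  by move=> /(@xgetPex _ 0 [set P | psd_mx P /\ P *m P = A]).
exists (W^T *m diag_mx (map_mx Num.sqrt d) *m W); split.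
  by apply/psd_mx_congr/psd_mx_diag => j; rewrite mxE sqrtr_ge0.
have WW : W *m W^T = 1%:M by apply: mulmx1C.
rewrite !mulmxA -(mulmxA _ W) WW mulmx1 -(mulmxA W^T) mulmx_diag AE.
congr (_ *m diag_mx _ *m _).
by apply/rowP => j; rewrite !mxE -expr2 sqr_sqrtr.
Qed.

Lemma psd_mx_trace_ge0 {R : realType} {m n} (E : 'M[R]_(m, n)) (K : 'M[R]_n) :
  psd_mx K -> 0 <= \tr (E *m K *m E^T).
Proof.
move=> [_ K0]; apply: sumr_ge0 => i _.
have := K0 (row i E)^T; rewrite trmxK -row_mul.
suff <- : (row i (E *m K) *m (row i E)^T) 0 0 = (E *m K *m E^T) i i by [].
by rewrite !mxE; apply: eq_bigr => j _; rewrite !mxE.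
Qed.

(** For symmetric [K], [U *m K] is normal to the Stiefel manifold at [U]; its product with a chord
    is therefore quadratic in the chord. The two mixed traces agree by transposition. *)
Lemma frob_inner_mulmx_sqr {R : realType} {n p} (U V : 'M[R]_(n, p)) (K : 'M[R]_p) :
  U^T *m U = 1%:M -> V^T *m V = 1%:M -> K^T = K ->
  \tr ((U - V) *m K *m (U - V)^T) = 2 * frob_inner (U - V) (U *m K).
Proof.
move=> hU hV hK.
have E : \tr (U^T *m V *m K) = \tr (V^T *m U *m K).
  by rewrite -mxtrace_tr !trmx_mul trmxK hK mxtrace_mulC.
have tB : (U - V)^T = U^T - V^T by rewrite linearB.
rewrite mxtrace_mulC mulmxA /frob_inner tB !(mulmxBl, mulmxBr, mulmxA) hU hV mul1mx.
by rewrite !raddfB /= E; ring.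
Qed.

(* [M = U H] with [H >= 1] lies outside of the Stiefel manifold in the direction
   normal to it at [U], and the projection [M |-> U] does not expand. *)
Lemma stiefel_projection_lipschitz {R : realType} {n p} (U V : 'M[R]_(n, p))
    (H G : 'M[R]_p) :
  St U -> St V -> psd_mx (H - 1%:M) -> psd_mx (G - 1%:M) ->
  frob_norm (U - V) <= frob_norm (U *m H - V *m G).
Proof.
move=> hU hV hK hL; set E := U - V.
set F := U *m (H - 1%:M) - V *m (G - 1%:M).
have -> : U *m H - V *m G = E + F.
  by rewrite /E /F !mulmxBr !mulmx1; apply/matrixP => i j; rewrite !mxE; ring.
(* Since [|E + F|^2 = |E|^2 + 2 <E, F> + |F|^2], this sign suffices; each of the two normal terms of
   [F] contributes half of a nonnegative trace. *)
have EF0 : 0 <= frob_inner E F.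
  have := psd_mx_trace_ge0 (U - V) _ hK; rewrite (frob_inner_mulmx_sqr _ _ _ hU hV (proj1 hK)).
  have := psd_mx_trace_ge0 (V - U) _ hL; rewrite (frob_inner_mulmx_sqr _ _ _ hV hU (proj1 hL)).
  rewrite -opprB -/E frob_innerNl => h2 h1.
  rewrite frob_innerC /F frob_innerDl frob_innerNl !(frob_innerC _ E).
  by lra.
clearbody E F.
rewrite ler_frob_norm [leRHS]frob_innerDl !(frob_innerC _ (E + F)) !frob_innerDl.
by rewrite (frob_innerC F E); have := frob_inner_ge0 F; lra.
Qed.

(** * Principal logarithm of an orthogonal matrix *)

Lemma expr_diag_mx {R : realType} {n} (d : 'rV[R]_n) k :
  diag_mx d ^+ k = diag_mx (map_mx (fun x => x ^+ k) d).
Proof.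
elim: k => [|k IH].
  rewrite expr0 -[1]/(1%:M : 'M[R]_n) -diag_const_mx; congr diag_mx.
  by apply/rowP => j; rewrite !mxE expr0.
rewrite exprS IH -[_ * _]/(_ *m _) mulmx_diag; congr diag_mx.
by apply/rowP => j; rewrite !mxE exprS.
Qed.

(** [J] acts as an imaginary unit. The relation [J *m J = -1] is asked only after multiplication by
    [D], so that [J] may degenerate where [D] vanishes, at rotation angle zero. *)
Lemma expr_rotation {R : realType} {n} (J D : 'M[R]_n) k :
  J *m D = D *m J -> J *m J *m D = - D ->
  (J *m D) ^+ k = if odd k then (-1) ^+ k.-1./2 *: (J *m D ^+ k)
                  else (-1) ^+ k./2 *: D ^+ k.
Proof.
move=> JD JJD; have DX h : J *m D ^+ h = D ^+ h *m J.
  elim: h => [|h IH]; first by rewrite expr0 mulmx1 mul1mx.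
  by rewrite exprS -[D * _]/(D *m _) mulmxA JD -mulmxA IH mulmxA.
elim: k => [|k IH]; first by rewrite /= !expr0 scale1r.
rewrite exprSr IH -[LHS]/(_ *m _) /=; case: ifP => ok /=.
  rewrite -scalemxAl DX -!mulmxA (mulmxA J) JJD mulmxN exprSr.
  rewrite scalerN -scaleNr; congr (_ *: _).
  by case: k ok {IH} => [//|k] _ /=; rewrite exprS mulN1r.
rewrite -scalemxAl mulmxA -DX -mulmxA -[D ^+ k *m D]/(D ^+ k * D).
by rewrite -exprSr.
Qed.

Lemma exp_mx_rotation {R : realType} {n} (J : 'M[R]_n) (theta : 'rV[R]_n) :
  J *m diag_mx theta = diag_mx theta *m J ->
  J *m J *m diag_mx theta = - diag_mx theta ->
  exp_mx (J *m diag_mx theta) = diag_mx (map_mx cos theta) + J *m diag_mx (map_mx sin theta).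
Proof.
move=> JD JJD; apply: exp_mx_eq => i j.
have -> : (diag_mx (map_mx cos theta) + J *m diag_mx (map_mx sin theta)) i j =
    cos (theta 0 j) * (i == j)%:R + J i j * sin (theta 0 j).
  rewrite mul_mx_diag !mxE.
  by case: eqVneq => [->|_]; rewrite ?mulr1n ?mulr0n ?mulr1 ?mulr0.
have -> : (fun k : nat => k`!%:R^-1 * ((J *m diag_mx theta) ^+ k) i j) =
    (fun k => (cos_coeff (theta 0 j) k) * (i == j)%:R + J i j * sin_coeff (theta 0 j) k).
  apply/funext => k; rewrite expr_rotation // expr_diag_mx /cos_coeff /sin_coeff /=.
  case: ifP => ok; rewrite ?mul_mx_diag !mxE /=.
    by rewrite !mul0r add0r mul1r; ring.
  rewrite !mul0r mulr0 addr0 mul1r -exprnP.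
  by case: eqVneq => [->|_]; rewrite ?mulr1n ?mulr0n ?mulr0//; ring.
rewrite [X in X @ _ --> _](_ : _ = (fun N => series (cos_coeff (theta 0 j)) N * (i == j)%:R +
    J i j * series (sin_coeff (theta 0 j)) N)); last first.
  apply/funext => N; rewrite /series /= big_split /= mulr_suml mulr_sumr //.
rewrite sin.unlock cos.unlock; apply: cvgD; [apply: cvgMl|apply: cvgMr].
  exact: is_cvg_series_cos_coeff.
exact: is_cvg_series_sin_coeff.
Qed.

(** Commuting with [diag_mx c] means that [K i j] vanishes unless [c 0 i = c 0 j], and then [f]
    takes the same value at both. *)
Lemma comm_diag_map {R : realType} {n} (K : 'M[R]_n) (c : 'rV[R]_n) (f : R -> R) :
  K *m diag_mx c = diag_mx c *m K ->
  K *m diag_mx (map_mx f c) = diag_mx (map_mx f c) *m K.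
Proof.
move=> /matrixP H; apply/matrixP => i j; have := H i j.
rewrite !mul_mx_diag !mul_diag_mx !mxE.
have [-> _|Kij] := eqVneq (K i j) 0; first by rewrite mul0r mulr0.
by rewrite mulrC => /(mulIf Kij) ->; rewrite mulrC.
Qed.

Lemma orthogonal_comm_tr {R : realType} {n} (Q X : 'M[R]_n) :
  orthogonal_mx Q -> X *m Q = Q *m X -> X *m Q^T = Q^T *m X.
Proof.
move=> hQ XQ; have QQ : Q *m Q^T = 1%:M by apply: mulmx1C.
by rewrite -[LHS]mul1mx -hQ -mulmxA (mulmxA Q) -XQ -mulmxA QQ mulmx1.
Qed.

(** Applying [Y] twice to the eigenvector [a + i b] and reading a coordinate [j] where it is nonzero
    gives [z^2 = - theta_j^2]; so [z] is purely imaginary unless [y = 0]. *)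
Lemma eigenvalue_rotation_Im {R : realType} {n} (Y : 'M[R]_n) (theta : 'rV[R]_n) (z : R[i]) :
  Y *m Y = - diag_mx (map_mx (fun x => x ^+ 2) theta) ->
  eigenvalue (map_mx (real_complex R) Y) z ->
  complex.Im z = 0 \/ exists j, complex.Im z ^+ 2 = theta 0 j ^+ 2.
Proof.
move=> YY /eigenvalue_real_pair[a [b [ab0 aY bY]]].
set x := complex.Re z in aY bY *; set y := complex.Im z in aY bY *.
have [j abj] : exists j, (a 0 j != 0) || (b 0 j != 0).
  by case/orP: ab0 => /rV0Pn[j hj]; exists j; rewrite hj ?orbT.
have e1 : (x ^+ 2 - y ^+ 2 + theta 0 j ^+ 2) * a 0 j = 2 * x * y * b 0 j.
  have /rowP/(_ j) := congr1 (mulmx a) YY.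
  rewrite mulmxA aY mulmxBl -!scalemxAl aY bY mulmxN mul_mx_diag !mxE => e.
  by lra.
have e2 : (x ^+ 2 - y ^+ 2 + theta 0 j ^+ 2) * b 0 j = - (2 * x * y * a 0 j).
  have /rowP/(_ j) := congr1 (mulmx b) YY.
  rewrite mulmxA bY mulmxDl -!scalemxAl aY bY mulmxN mul_mx_diag !mxE => e.
  by lra.
set p := x ^+ 2 - y ^+ 2 + theta 0 j ^+ 2 in e1 e2.
have ab2 : a 0 j ^+ 2 + b 0 j ^+ 2 != 0.
  by rewrite paddr_eq0 ?sqr_ge0// !sqrf_eq0 negb_and.
have xy0 : x * y = 0.
  apply/eqP; have : (x * y) * (a 0 j ^+ 2 + b 0 j ^+ 2) == 0.
    have h : (2 * x * y) * (a 0 j ^+ 2 + b 0 j ^+ 2) = (p * a 0 j) * b 0 j - (p * b 0 j) * a 0 j.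
      by rewrite e1 e2; ring.
    by apply/eqP; lra.
  by rewrite mulf_eq0 (negbTE ab2) orbF.
have [y0|y0] := eqVneq y 0; first by left.
right; exists j; have x0 : x = 0.
  by apply/eqP; move/eqP: xy0; rewrite mulf_eq0 (negbTE y0) orbF.
have : p = 0.
  case/orP: abj => h.
    by apply/eqP; rewrite -(mulIr_eq0 _ (mulIf h)) e1 x0; apply/eqP; ring.
  by apply/eqP; rewrite -(mulIr_eq0 _ (mulIf h)) e2 x0; apply/eqP; ring.
by rewrite /p x0; lra.
Qed.

Lemma eigenvalue_conj {R : realType} {n} (W X Y : 'M[R]_n) z :
  orthogonal_mx W -> W *m Y = X *m W ->
  eigenvalue (map_mx (real_complex R) Y) z -> eigenvalue (map_mx (real_complex R) X) z.
Proof.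
move=> hW WY /eigenvalueP[v vY v0]; have WW : W *m W^T = 1%:M by apply: mulmx1C.
apply/eigenvalueP; exists (v *m map_mx (real_complex R) W^T).
  have -> : X = W *m Y *m W^T by rewrite WY -mulmxA WW mulmx1.
  rewrite -mulmxA -map_mxM !mulmxA hW mul1mx map_mxM mulmxA vY.
  by rewrite -scalemxAl.
apply: contraNneq v0 => v0.
rewrite -[v]mulmx1 -(map_mx1 (real_complex R)) -hW map_mxM mulmxA v0 mul0mx //.
Qed.

(* In an orthonormal eigenbasis of the symmetric part of [Q], with eigenvalues
   [c_j = cos theta_j], the skew part [K] satisfies [K^2 = - diag (sin theta_j)^2]
   and the logarithm is [Y = K diag (theta_j / sin theta_j)]; where [sin theta_j = 0],
   the column of [K] vanishes and so does the junk value of the quotient. *)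
Lemma principal_log_exists {R : realType} {n} (Q : 'M[R]_n) :
  orthogonal_mx Q -> ~~ eigenvalue Q (-1) ->
  exists Y : 'M[R]_n, [/\ Y^T = - Y, is_log_mx Q Y &
    forall X, X *m Q = Q *m X -> X *m Y = Y *m X].
Proof.
move=> hQ hev; pose C := 2^-1 *: (Q + Q^T).
have CT : C^T = C by rewrite /C linearZ linearD /= trmxK addrC.
have [W [c [hW CE]]] := real_spectral C CT.
have WW : W *m W^T = 1%:M by apply: mulmx1C.
pose P := W *m Q *m W^T.
have [K KE] : exists K, K = P - diag_mx c by eexists.
have hP : P^T *m P = 1%:M.
  by rewrite /P !trmx_mul trmxK !mulmxA -(mulmxA _ W^T) hW mulmx1 -(mulmxA W) hQ mulmx1.
have hP' : P *m P^T = 1%:M by apply: mulmx1C.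
have cE : diag_mx c = W *m C *m W^T.
  by rewrite CE !mulmxA WW mul1mx -mulmxA WW mulmx1.
have PT : P^T = diag_mx c - K.
  have : 2 *: diag_mx c = P + P^T.
    rewrite cE /C -scalemxAr -scalemxAl scalerA divff// scale1r mulmxDr mulmxDl.
    by rewrite /P !trmx_mul trmxK !mulmxA.
  rewrite KE scaler_nat mulr2n => h; rewrite opprB addrA h addrC addKr //.
have PE : P = diag_mx c + K by rewrite KE addrC subrK.
have KT : K^T = - K by rewrite {1}KE linearB /= PT tr_diag_mx addrC addKr.
(* Normality of [P = D + K], where [P^T = D - K], amounts to [2 (K D - D K) = 0]. *)
have Kc : K *m diag_mx c = diag_mx c *m K.
  have : P *m P^T = P^T *m P by rewrite hP hP'.
  rewrite PT PE; move: (diag_mx c) => D; rewrite !mulmxBl !mulmxDl !mulmxBr !mulmxDr => e.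
  have : 2 *: (K *m D - D *m K) = 0.
    by move: e; move: (K *m D) (D *m K) (D *m D) (K *m K) => M N M' N' /matrixP e;
      apply/matrixP => i j; have := e i j; rewrite !mxE => {}e; lra.
  by move/eqP; rewrite scaler_eq0 pnatr_eq0 /= subr_eq0 => /eqP.
have KK : K *m K = diag_mx (map_mx (fun x => x ^+ 2 - 1) c).
  have : P *m P^T = 1%:M by [].
  rewrite PT PE mulmxBr !mulmxDl Kc mulmx_diag => e.
  have -> : K *m K = diag_mx (\row_j (c 0 j * c 0 j)) - 1%:M.
    by rewrite -e; apply/matrixP => i j; rewrite !mxE; ring.
  apply/matrixP => i j; rewrite !mxE expr2; case: eqVneq => _; rewrite ?mulr1n ?mulr0n //.
  by rewrite subr0.
have rowK j : \sum_i K j i ^+ 2 = 1 - c 0 j ^+ 2.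
  have /matrixP/(_ j j) := KK; rewrite !mxE eqxx mulr1n.
  have -> : \sum_k K j k * K k j = - \sum_i K j i ^+ 2.
    rewrite -sumrN; apply: eq_bigr => i _; have /matrixP/(_ i j) := KT.
    by rewrite !mxE => ->; ring.
  by move=> h; lra.
have c2 j : -1 <= c 0 j <= 1.
  rewrite -ler_norml -ler_sqr ?nnegrE// real_normK ?num_real// expr1n -subr_ge0 -rowK.
  by apply: sumr_ge0 => i _; exact: sqr_ge0.
have K0 j : c 0 j ^+ 2 = 1 -> forall i, K j i = 0.
  move=> cj i; have := rowK j; rewrite cj subrr => /psumr_eq0P h.
  by apply/eqP; rewrite -sqrf_eq0 h// => k _; exact: sqr_ge0.
have K0' j : c 0 j ^+ 2 = 1 -> forall i, K i j = 0.
  move=> cj i; have /matrixP/(_ j i) := KT; rewrite !mxE.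
  by move=> ->; rewrite K0 // oppr0.
(* If [c_j = -1], row [j] of [K] vanishes, and row [j] of [W] would be an eigenvector of [Q] for the
   excluded eigenvalue. *)
have cN1 j : c 0 j != -1.
  apply: contraNneq hev => cj; apply/eigenvalueP.
  have dW : delta_mx 0 j *m W != 0 :> 'rV[R]_n.
    apply/eqP => /(congr1 (mulmx^~ W^T)) /=; rewrite -mulmxA WW mulmx1 mul0mx.
    by move=> /matrixP/(_ 0 j); rewrite !mxE !eqxx /= => /eqP; rewrite oner_eq0.
  exists (delta_mx 0 j *m W) => //.
  have -> : delta_mx 0 j *m W *m Q = delta_mx 0 j *m P *m W :> 'rV[R]_n.
    by rewrite /P !mulmxA -(mulmxA _ W^T) hW mulmx1.
  rewrite scalemxAl; congr (_ *m W).
  apply/rowP => i; rewrite -rowE mxE PE mxE [X in _ + X]K0 ?cj ?sqrrN ?expr1n// addr0.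
  rewrite !mxE eqxx /= cj eq_sym; case: eqVneq => _; rewrite ?mulr1n ?mulr0n ?mulr1 ?mulr0 //.
have sin2 j : sin (acos (c 0 j)) ^+ 2 = 1 - c 0 j ^+ 2.
  rewrite sin_acos // sqr_sqrtr // -rowK.
  by apply: sumr_ge0 => i _; exact: sqr_ge0.
have sin0 j : sin (acos (c 0 j)) = 0 -> c 0 j = 1.
  move=> s0; have := sin2 j; rewrite s0 expr0n /= => /esym/eqP.
  rewrite subr_eq0 eq_sym sqrf_eq1 => /orP[/eqP//|/eqP h].
  by move: (cN1 j); rewrite h eqxx.
pose theta := map_mx acos c.
pose J := K *m diag_mx (map_mx (fun x => (sin (acos x))^-1) c).
have JD : J *m diag_mx theta = diag_mx theta *m J.
  by rewrite /J mulmxA -comm_diag_map // -!mulmxA [in RHS]diag_mxC.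
have JJD : J *m J *m diag_mx theta = - diag_mx theta.
  rewrite /J mulmxA -(mulmxA K) -comm_diag_map // !mulmxA KK -!mulmxA !mulmx_diag.
  rewrite -raddfN /=; congr diag_mx; apply/rowP => j; rewrite !mxE.
  have [/sin0 ->|s0] := eqVneq (sin (acos (c 0 j))) 0.
    by rewrite acos1 !mulr0 oppr0.
  have -> : c 0 j ^+ 2 - 1 = - sin (acos (c 0 j)) ^+ 2 by rewrite sin2 opprB.
  by field.
pose Y' := J *m diag_mx theta.
have expY' : exp_mx Y' = P.
  rewrite exp_mx_rotation // PE; congr (_ + _).
    by congr diag_mx; apply/rowP => j; rewrite !mxE acosK// in_itv /= c2.
  rewrite /J -mulmxA mulmx_diag mul_mx_diag; apply/matrixP => i j; rewrite [LHS]mxE.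
  have [/sin0 cj|s0] := eqVneq (sin (acos (c 0 j))) 0.
    by rewrite K0' ?mul0r // cj expr1n.
  by rewrite !mxE mulVf ?mulr1.
have Y'E : Y' = K *m diag_mx (map_mx (fun x => (sin (acos x))^-1 * acos x) c).
  by rewrite /Y' /J -mulmxA mulmx_diag; congr (_ *m diag_mx _); apply/rowP => j; rewrite !mxE.
have Y'T : Y'^T = - Y'.
  by rewrite Y'E trmx_mul tr_diag_mx KT mulmxN -comm_diag_map.
have Y'2 : Y' *m Y' = - diag_mx (map_mx (fun x => x ^+ 2) theta).
  clearbody J; rewrite /Y' mulmxA -(mulmxA J) -JD !mulmxA JJD mulNmx mulmx_diag.
  by congr (- diag_mx _); apply/rowP => j; rewrite !mxE expr2.
clearbody Y'.
have WY : W *m (W^T *m Y' *m W) = Y' *m W by rewrite !mulmxA WW mul1mx.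
exists (W^T *m Y' *m W); split.
- by rewrite !trmx_mul trmxK Y'T mulNmx mulmxN mulmxA.
- split.
    rewrite -[LHS]mul1mx -hW -mulmxA (exp_mx_intertwine _ _ _ WY) expY' /P.
    by rewrite !mulmxA hW mul1mx -mulmxA hW mulmx1.
  move=> z /(eigenvalue_conj _ _ _ _ hW WY)/(eigenvalue_rotation_Im _ theta).
  case=> [//||].
  + by move=> ->; rewrite normr0 pi_gt0.
  + move=> [j /eqP]; rewrite eqf_sqr !mxE => h.
    have cj : -1 < c 0 j <= 1 by rewrite lt_neqAle eq_sym cN1 c2.
    have -> : `|complex.Im z| = acos (c 0 j).
      by case/orP: h => /eqP ->; rewrite ?normrN ger0_norm ?acos_ge0.
    exact: acos_ltpi.
(* Commuting with [Q] implies commuting with [Q^T], hence with the symmetric and skew parts from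
   which the logarithm is built. Uniqueness relies on this. *)
- move=> X XQ; pose X' := W *m X *m W^T.
  have XQT := orthogonal_comm_tr _ _ hQ XQ.
  have conjM (M N : 'M[R]_n) : (W *m M *m W^T) *m (W *m N *m W^T) = W *m (M *m N) *m W^T.
    by rewrite !mulmxA -(mulmxA _ W^T) hW mulmx1.
  have XP : X' *m P = P *m X' by rewrite /X' /P !conjM XQ.
  have Xc : X' *m diag_mx c = diag_mx c *m X'.
    by rewrite cE /X' !conjM /C -scalemxAr -scalemxAl mulmxDr mulmxDl XQ XQT.
  have XE : X = W^T *m X' *m W by rewrite /X' !mulmxA hW mul1mx -mulmxA hW mulmx1.
  clearbody X'; have XK : X' *m K = K *m X' by rewrite KE mulmxBr mulmxBl XP Xc.
  have XY : X' *m Y' = Y' *m X'.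
    by rewrite Y'E mulmxA XK -!mulmxA [X in _ *m X]comm_diag_map.
  have conjM' (M N : 'M[R]_n) : (W^T *m M *m W) *m (W^T *m N *m W) = W^T *m (M *m N) *m W.
    by rewrite !mulmxA -(mulmxA _ W) WW mulmx1.
  by rewrite XE !conjM' XY.
Qed.

(** * Uniqueness of the principal logarithm *)

Lemma exp_mx_similitude {R : realType} (x y : R) :
  exp_mx (block_mx x%:M (- y)%:M y%:M x%:M : 'M[R]_(1 + 1)) =
  block_mx (expR x * cos y)%:M (- (expR x * sin y))%:M
           (expR x * sin y)%:M (expR x * cos y)%:M.
Proof.
(* [J] represents the imaginary unit, and the matrix to be exponentiated represents [x + i y]. *)
pose J : 'M[R]_(1 + 1) := block_mx 0 (-1)%:M 1%:M 0.
have JZ (s : R) : J *m s%:M = block_mx 0 (- s)%:M s%:M 0.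
  by rewrite mul_mx_scalar scale_block_mx !scaler0 !scale_scalar_mx mulrN1 mulr1.
have JC (s : R) : J *m s%:M = s%:M *m J by exact: scalar_mxC.
have JJ (s : R) : J *m J *m s%:M = - s%:M.
  rewrite -mulmxA JZ mulmx_block !mul0mx !mulmx0 !addr0 !add0r -!scalar_mxM.
  by rewrite [in RHS](scalar_mx_block 1 1) opp_block_mx !oppr0 mulN1r mul1r -!raddfN.
have D (s : R) : s%:M = diag_mx (const_mx s) :> 'M[R]_(1 + 1) by rewrite diag_const_mx.
have -> : block_mx x%:M (- y)%:M y%:M x%:M = x%:M + J *m y%:M :> 'M[R]_(1 + 1).
  by rewrite JZ (scalar_mx_block 1 1 x) add_block_mx !addr0 !add0r.
rewrite exp_mxD; last by rewrite -scalar_mxC.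
rewrite exp_mx_scalar.
have -> : exp_mx (J *m y%:M) = (cos y)%:M + J *m (sin y)%:M.
  by rewrite D exp_mx_rotation -?D // !map_const_mx -!D.
rewrite JZ (scalar_mx_block 1 1 (cos y)) add_block_mx !addr0 !add0r.
by rewrite mul_scalar_mx scale_block_mx !scale_scalar_mx mulrN.
Qed.

Lemma expR_cos_sin_eq1 {R : realType} (x y : R) :
  expR x * cos y = 1 -> expR x * sin y = 0 -> x = 0 /\ cos y = 1.
Proof.
move=> hc /eqP; rewrite mulf_eq0 gt_eqF ?expR_gt0//= => /eqP hs.
have c0 : 0 < cos y by rewrite -(pmulr_rgt0 _ (expR_gt0 x)) hc.
have c1 : cos y = 1.
  have := cos2Dsin2 y; rewrite hs expr0n addr0 => /eqP.
  rewrite sqrf_eq1 => /orP[/eqP//|/eqP h].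
  by move: c0; rewrite h; lra.
by split=> //; apply: expR_inj; rewrite expR0 -hc c1 mulr1.
Qed.

Lemma cos_eq1_lt2pi {R : realType} (y : R) : cos y = 1 -> `|y| < 2 * pi -> y = 0.
Proof.
move=> cy y2; have [//|y0] := eqVneq y 0.
have h : 0 < `|y| / 2 < pi.
  by rewrite divr_gt0 ?normr_gt0//= ltr_pdivrMr// mulrC.
have s0 := sin_gt0_pi h; have : cos `|y| = 1 by rewrite cos_norm.
have -> : `|y| = (`|y| / 2) *+ 2 by rewrite -mulr_natr divfK.
rewrite cos_mulr2n => e; suff : sin (`|y| / 2) ^+ 2 = 0.
  by move/eqP; rewrite sqrf_eq0 gt_eqF.
by have := cos2Dsin2 (`|y| / 2); lra.
Qed.

(** The conclusion says [e^z = 1]. The two rows [a], [b] intertwine [Z] with the real 2 x 2 matrix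
    of [z]; as they may be dependent, [e^z - 1] is cancelled at a single coordinate where [a] or [b]
    is nonzero. *)
Lemma exp_mx_eq1_eigenvalue {R : realType} {n} (Z : 'M[R]_n) (z : R[i]) :
  exp_mx Z = 1%:M -> eigenvalue (map_mx (real_complex R) Z) z ->
  complex.Re z = 0 /\ cos (complex.Im z) = 1.
Proof.
move=> eZ /eigenvalue_real_pair[a [b [ab0 aZ bZ]]].
set x := complex.Re z in aZ bZ *; set y := complex.Im z in aZ bZ *.
have [j abj] : exists j, (a 0 j != 0) || (b 0 j != 0).
  by case/orP: ab0 => /rV0Pn[j hj]; exists j; rewrite hj ?orbT.
pose C : 'M[R]_(1 + 1, n) := col_mx a b.
have CZ : C *m Z = block_mx x%:M (- y)%:M y%:M x%:M *m C.
  by rewrite mul_col_mx mul_block_col aZ bZ !mul_scalar_mx scaleNr.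
have := exp_mx_intertwine _ _ _ CZ; rewrite eZ mulmx1 exp_mx_similitude.
rewrite mul_block_col !mul_scalar_mx => /eq_col_mx[/rowP/(_ j) + /rowP/(_ j)].
rewrite !mxE; move: (expR x * cos y) (expR x * sin y) (expR_cos_sin_eq1 x y) => c s H ea eb.
have ab2 : a 0 j ^+ 2 + b 0 j ^+ 2 != 0.
  by rewrite paddr_eq0 ?sqr_ge0// !sqrf_eq0 negb_and.
have ea' : c * a 0 j - s * b 0 j - a 0 j = 0 by lra.
have eb' : s * a 0 j + c * b 0 j - b 0 j = 0 by lra.
apply: H; apply/eqP.
  rewrite -subr_eq0 -(mulIr_eq0 _ (mulIf ab2)); apply/eqP.
  have -> : (c - 1) * (a 0 j ^+ 2 + b 0 j ^+ 2) =
    (c * a 0 j - s * b 0 j - a 0 j) * a 0 j + (s * a 0 j + c * b 0 j - b 0 j) * b 0 j by ring.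
  by rewrite ea' eb' !mul0r addr0.
rewrite -(mulIr_eq0 _ (mulIf ab2)); apply/eqP.
have -> : s * (a 0 j ^+ 2 + b 0 j ^+ 2) =
    (s * a 0 j + c * b 0 j - b 0 j) * a 0 j - (c * a 0 j - s * b 0 j - a 0 j) * b 0 j by ring.
by rewrite ea' eb' !mul0r subr0.
Qed.

(** If [Z^(k+2) = 0], multiplying [exp_mx Z = 1] by [Z^k] leaves [Z^k + Z^(k+1) = Z^k], so the order
    of nilpotency descends to 1. *)
Lemma exp_mx_eq1_nilpotent {R : realType} {n} (Z : 'M[R]_n) N :
  exp_mx Z = 1%:M -> Z ^+ N = 0 -> Z = 0.
Proof.
move=> eZ; suff H k : Z ^+ k.+2 = 0 -> Z ^+ k.+1 = 0.
  move=> ZN; have : Z ^+ N.+1 = 0 by rewrite exprS ZN mulr0.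
  by elim: N {ZN} => [|N IH]; [rewrite expr1|move/H].
move=> Zk2; have Zk i : Z ^+ (k + i.+2) = 0.
  by rewrite !addnS -!addSn exprD Zk2 mul0r.
pose u N := Z ^+ k *m series (fun k : nat => (k`!%:R^-1 : R) *: Z ^+ k) N.
have u1 : u @ \oo --> Z ^+ k.
  rewrite -[X in _ --> X]mulmx1 -eZ; apply: cvg_mulmx; [exact: cvg_cst | exact: cvg_exp_mx].
have u2 : u @ \oo --> Z ^+ k + Z ^+ k.+1.
  apply: cvg_near_cst; near=> N'.
  have -> : N' = (N' - 2)%N.+2 by rewrite -addn2 subnK //; near: N'; exists 2%N.
  rewrite /u /series /= big_nat_recl // big_nat_recl //= expr0 expr1 !invr1 !scale1r.
  rewrite mulmxDr mulmxDr mulmx1 addrA -[Z ^+ k *m Z]/(Z ^+ k * Z) -exprSr.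
  rewrite mulmx_sumr big1 ?addr0// => i _.
  by rewrite -scalemxAr -[_ *m _]/(_ * _) -exprD Zk scaler0.
have e : Z ^+ k = Z ^+ k + Z ^+ k.+1.
  by apply: (@cvg_unique _ _ (u @ \oo)); [exact: norm_hausdorff|exact: u1|exact: u2].
by apply: (addrI (Z ^+ k)); rewrite addr0 -e.
Unshelve. all: by end_near. Qed.

Lemma trig_mx_diag_eigenvalue {F : fieldType} {n} (A : 'M[F]_n) i :
  is_trig_mx A -> eigenvalue A (A i i).
Proof.
move=> hA; rewrite eigenvalue_root_char char_poly_trig //.
by rewrite rootE horner_prod (bigD1 i) //= hornerXsubC subrr mul0r.
Qed.

Lemma trig_mx_nilpotent {F : fieldType} {n} (A : 'M[F]_n) :
  is_trig_mx A -> (forall i, A i i = 0) -> A ^+ n = 0.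
Proof.
case: n A => [|n] A hA A0; first by apply/matrixP => -[].
have := Cayley_Hamilton A; rewrite char_poly_trig //.
under eq_bigr do rewrite A0 subr0.
by rewrite prodr_const card_ord rmorphXn /= horner_mx_X.
Qed.

Lemma expr_conj_unitmx {F : fieldType} {n} (P M : 'M[F]_n) k :
  P \in unitmx -> (P *m M *m invmx P) ^+ k = P *m M ^+ k *m invmx P.
Proof.
move=> hP; elim: k => [|k IH]; first by rewrite !expr0 mulmx1 mulmxV.
by rewrite !exprS IH -[LHS]/(_ *m _) !mulmxA mulmxKV // -[M * _]/(M *m _) !mulmxA.
Qed.

Lemma map_mx_expr {F G : fieldType} (f : {rmorphism F -> G}) {n} (M : 'M[F]_n) k :
  map_mx f (M ^+ k) = map_mx f M ^+ k.
Proof.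
elim: k => [|k IH]; first by rewrite !expr0 map_mx1.
by rewrite !exprS -[M * _]/(M *m _) map_mxM IH.
Qed.

(* [Z = X - Y] satisfies [exp Z = 1]; by simultaneous triangularization, its
   eigenvalues are differences of eigenvalues of [X] and [Y], hence multiples of
   [2 i pi] of modulus less than [2 pi]: so [Z] is nilpotent, and then null. *)
Lemma exp_mx_principal_inj {R : realType} {n} (X Y : 'M[R]_n) :
  X *m Y = Y *m X -> exp_mx X = exp_mx Y ->
  (forall z, eigenvalue (map_mx (real_complex R) X) z -> `|complex.Im z| < pi) ->
  (forall z, eigenvalue (map_mx (real_complex R) Y) z -> `|complex.Im z| < pi) ->
  X = Y.
Proof.
move=> XY eXY hX hY; pose toC := map_mx (real_complex R) : 'M[R]_n -> 'M[R[i]]_n.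
have eZ : exp_mx (X - Y) = 1%:M.
  rewrite exp_mxD; last by rewrite mulmxN mulNmx XY.
  by rewrite eXY -exp_mxD ?subrr ?exp_mx0// mulmxN mulNmx.
have [P P_u /andP[TX TY]] : exists2 P : 'M[R[i]]_n, P \is unitarymx &
    similar_trig P (toC X) && similar_trig P (toC Y).
  by apply: cotrigonalization2; rewrite -!map_mxM XY.
have Pu := unitarymx_unit P_u.
have Pfree : row_free P by rewrite row_free_unit.
have st A : stablemx P A by rewrite stablemx_unit.
pose T := conjmx P (toC (X - Y)).
have TE : T = conjmx P (toC X) - conjmx P (toC Y).
  by rewrite /T /toC !conjumx // map_mxB mulmxBr mulmxBl.
have TX' : is_trig_mx (conjmx P (toC X)) by move: TX; rewrite /simmx_to_for.
have TY' : is_trig_mx (conjmx P (toC Y)) by move: TY; rewrite /simmx_to_for.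
have TT : is_trig_mx T.
  apply/is_trig_mxP => i j ij; rewrite TE mxE [X in _ + X]mxE.
  by rewrite (is_trig_mxP TX')// (is_trig_mxP TY')// subr0.
have ev A i : is_trig_mx (conjmx P A) -> eigenvalue A (conjmx P A i i).
  by move=> /(trig_mx_diag_eigenvalue _ i); apply: eigenvalue_conjmx.
have T0 i : T i i = 0.
  have [re cs] := exp_mx_eq1_eigenvalue _ _ eZ (ev _ i TT).
  have im : complex.Im (T i i) = 0.
    apply: cos_eq1_lt2pi cs _.
    have /hX hx := ev _ i TX'; have /hY hy := ev _ i TY'.
    rewrite -/T TE mxE [X in _ + X]mxE.
    have -> : forall u v : R[i], complex.Im (u - v) = complex.Im u - complex.Im v.
      by move=> [? ?] [? ?].
    by rewrite (le_lt_trans (ler_normB _ _))// mulr_natl mulr2n ltrD.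
  by apply/eqP; rewrite eq_complex re im !eqxx.
have TN := trig_mx_nilpotent T TT T0.
suff ZN : (X - Y) ^+ n = 0.
  by apply/eqP; rewrite -subr_eq0; apply/eqP; apply: exp_mx_eq1_nilpotent eZ ZN.
have : toC (X - Y) ^+ n = 0.
  move: TN; rewrite /T conjumx // expr_conj_unitmx // => /(congr1 (mulmx (invmx P))).
  rewrite mulmx0 -mulmxA mulKmx // => /(congr1 (mulmx^~ P)) /=.
  by rewrite mul0mx mulmxKV.
rewrite -map_mx_expr => /matrixP h.
by apply/matrixP => i j; have := h i j; rewrite !mxE => -[].
Qed.

(** The matrix chosen by [log_mx] commutes with its exponential [Q], hence with the constructed skew
    logarithm [Y]; injectivity of [exp_mx] on commuting matrices with spectrum in the strip then
    identifies them. *)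
Lemma principal_log_orthogonal {R : realType} {n} (Q : 'M[R]_n) :
  orthogonal_mx Q -> ~~ eigenvalue Q (-1) ->
  (log_mx Q)^T = - log_mx Q /\ exp_mx (log_mx Q) = Q.
Proof.
move=> hQ hev; have [Y [YT [eY hY] Ycomm]] := principal_log_exists Q hQ hev.
have [eX hX] : is_log_mx Q (log_mx Q).
  by apply: (@xgetPex _ 0 [set X | is_log_mx Q X]); exists Y.
have comm := exp_mx_intertwine _ _ _ (erefl (log_mx Q *m log_mx Q)).
rewrite eX in comm.
suff -> : log_mx Q = Y by rewrite YT eY.
by apply: (exp_mx_principal_inj _ _ (Ycomm _ comm) _ hX hY); rewrite eX eY.
Qed.

(** * Polar-light coordinates *)

Lemma frob_inner_col_mx {R : realType} {m n p} (A C : 'M[R]_(m, p)) (B D : 'M[R]_(n, p)) :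
  frob_inner (col_mx A B) (col_mx C D) = frob_inner A C + frob_inner B D.
Proof. by rewrite /frob_inner tr_col_mx mul_row_col mxtraceD. Qed.

(* [P <= 1] follows from [|P x| = |U_1 x| <= |x|]; then
   [P - P^2 = P (1 - P) P + (1 - P) P (1 - P) >= 0], and [P^-1 - 1] is congruent
   to it. *)
Lemma stiefel_polar_factor {R : realType} {p q} (U : 'M[R]_(p + q, p)) :
  let H := invsqrt_mx ((usubmx U)^T *m usubmx U) in
  St U -> usubmx U \in unitmx ->
  psd_mx (H - 1%:M) /\ orthogonal_mx (usubmx U *m H).
Proof.
move=> H hU Uu; set U1 := usubmx U in H Uu *.
have [hP PP] := sqrt_mxP _ (psd_mx_gram U1).
have [P PE] : exists P, P = sqrt_mx (U1^T *m U1) by eexists.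
rewrite -PE in hP PP; have HE : H = invmx P by rewrite PE.
clearbody H.
have PT : P^T = P := proj1 hP.
have Pu : P \in unitmx.
  have : P *m P \in unitmx by rewrite PP unitmx_mul unitmx_tr Uu.
  by rewrite unitmx_mul => /andP[].
have HT : H^T = H by rewrite HE trmx_inv PT.
split; last first.
  rewrite /orthogonal_mx trmx_mul HT mulmxA -(mulmxA H) -PP HE mulmxA -(mulmxA _ P).
  by rewrite mulVmx // mulmxV // mulmx1.
have P1 : psd_mx (1%:M - P).
  split; first by rewrite linearB /= trmx1 PT.
  move=> x; rewrite mulmxBr mulmxBl mulmx1 [X in 0 <= X]mxE [X in _ + X]mxE subr_ge0.
  have tr1 (A : 'M[R]_1) : A 0 0 = \tr A by rewrite /mxtrace big_ord1.
  rewrite !tr1 -mulmxA -[leLHS]/(frob_inner x (P *m x)) -[leRHS]/(frob_inner x x).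
  rewrite (le_trans (frob_inner_le _ _))// -frob_norm_sqr expr2 ler_wpM2l ?frob_norm_ge0//.
  have -> : frob_norm (P *m x) = frob_norm (U1 *m x).
    by rewrite /frob_norm !trmx_mul PT -!mulmxA (mulmxA P) PP !mulmxA.
  have -> : frob_norm x = frob_norm (U *m x).
    by rewrite /frob_norm trmx_mul mulmxA -(mulmxA _ U^T) hU mulmx1.
  rewrite ler_frob_norm -[in leRHS](vsubmxK U) mul_col_mx frob_inner_col_mx.
  by rewrite lerDl frob_inner_ge0.
have -> : H - 1%:M = H^T *m (P^T *m (1%:M - P) *m P + (1%:M - P)^T *m P *m (1%:M - P)) *m H.
  have -> : P^T *m (1%:M - P) *m P + (1%:M - P)^T *m P *m (1%:M - P) = P - P *m P.
    rewrite (proj1 P1) PT !(mulmxBl, mulmxBr) !(mul1mx, mulmx1).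
    by apply/matrixP => i j; rewrite !mxE; ring.
  rewrite HT HE mulmxBr mulmxBl mulVmx // mul1mx mulmxA mulVmx // mul1mx mulmxV //.
by apply/psd_mx_congr/psd_mxD; apply: psd_mx_congr.
Qed.

Lemma psiE_expansive {R : realType} {p q} (U V : 'M[R]_(p + q, p)) :
  psi_dom U -> psi_dom V -> frob_norm (U - V) <= frob_norm (psiE U - psiE V).
Proof.
move=> [hU Uu Ue] [hV Vu Ve].
have [hH hO] := stiefel_polar_factor U hU Uu.
have [hG hO'] := stiefel_polar_factor V hV Vu.
have [lOT lO] := principal_log_orthogonal _ hO Ue.
have [lOT' lO'] := principal_log_orthogonal _ hO' Ve.
apply: (le_trans (stiefel_projection_lipschitz _ _ _ _ hU hV hH hG)).
have mulE (M : 'M[R]_(p + q, p)) (A : 'M[R]_p) :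
    M *m A = col_mx (usubmx M *m A) (dsubmx M *m A) by rewrite -mul_col_mx vsubmxK.
(* The lower blocks of [U H] and [V G] are already the second coordinates; the upper blocks are
   orthogonal, and are the exponentials of the first coordinates. *)
rewrite !mulE /psiE /polar_factor /= ler_frob_norm !opp_col_mx !add_col_mx.
rewrite !frob_inner_col_mx lerD2r -ler_frob_norm.
by rewrite -{1}lO -{1}lO'; apply: exp_mx_skew_lipschitz.
Qed.

(** * Curves on the Stiefel manifold *)

Lemma is_derive_mx {R : realType} {m n} (M : R -> 'M[R]_(m, n)) (d : 'M[R]_(m, n)) (t : R) :
  (forall i j, is_derive t (1 : R) (fun s => M s i j) (d i j)) -> is_derive t (1 : R) M d.
Proof.
move=> H; have dM : derivable M t 1 by apply/derivable_mxP => i j; apply: ex_derive.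
apply: DeriveDef => //; rewrite derive_mx //.
by apply/matrixP => i j; rewrite mxE; apply: derive_val.
Qed.

(** Differentiability on the whole line spares one-sided derivatives at 0 and 1. The normalized
    chord provides it, being defined for all real [t]. *)
Lemma distE_le_of_curve {R : realType} {n p} (U V : 'M[R]_(n, p))
    (c d : R -> 'M[R]_(n, p)) (k : R) :
  c 0 = U -> c 1 = V -> (forall t, t \in `[0, 1] -> St (c t)) ->
  (forall t : R, is_derive t (1 : R) c (d t)) -> continuous d ->
  (forall t, frob_norm (d t) <= k) ->
  (distE U V <= k%:E)%E.
Proof.
move=> c0 c1 cSt dc dcont dk.
have c'E t : derive1 c t = d t by rewrite derive1E; apply: derive_val.
have k0 : 0 <= k := le_trans (frob_norm_ge0 _) (dk 0).
apply: (@le_trans _ _ (curve_length c)).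
  apply: ereal_inf_lbound; exists c => //; split => //.
  split.
    apply: continuous_subspaceT => t; apply: differentiable_continuous.
    by apply/derivable1_diffP; apply: ex_derive.
  exists [:: 1]; split; first by rewrite /itv_partition /= ltr01 eqxx.
  move=> [|//] _ /=; exists d; split; first exact: continuous_subspaceT.
  by move=> t _; exact: dc.
rewrite /curve_length.
have -> : k%:E = (\int[lebesgue_measure]_(t in `[0%R, 1%R]) (cst k%:E) t)%E :> \bar R.
  by rewrite integral_cst//= lebesgue_measure_itv/= lte_fin ltr01 oppr0 adde0 mule1.
apply: ge0_le_integral.
- exact: measurable_itv.
- by move=> t _; rewrite lee_fin sqrtr_ge0.
- apply/measurable_EFinP; apply: measurable_funTS.
  rewrite (_ : (fun t => _) = fun t => frob_norm (d t)); last first.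
    by apply/funext => t; rewrite c'E.
  by apply: continuous_measurable_fun => t; exact: (cvg_frob_norm _ _ (dcont t)).
- exact: measurable_cst.
- by move=> t _; rewrite lee_fin c'E dk.
Qed.

Lemma frob_inner_mul_diag {R : realType} {n p} (X Y : 'M[R]_(n, p)) (a b : 'rV[R]_p) :
  frob_inner (X *m diag_mx a) (Y *m diag_mx b) =
  \sum_k a 0 k * b 0 k * (X^T *m Y) k k.
Proof.
rewrite /frob_inner trmx_mul tr_diag_mx -mulmxA (mulmxA X^T) mulmxA.
by apply: eq_bigr => k _; rewrite mul_mx_diag mul_diag_mx !mxE; ring.
Qed.

Lemma is_derive_invsqrt_chord {R : realType} (x t : R) :
  0 < 1 - t * (1 - t) * x ->
  is_derive t (1 : R) (fun s => (Num.sqrt (1 - s * (1 - s) * x))^-1)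
    ((1 - 2 * t) * x / 2 * (Num.sqrt (1 - t * (1 - t) * x))^-1 ^+ 3).
Proof.
set g := fun s : R => 1 - s * (1 - s) * x => g0.
have dg : is_derive t (1 : R) g (- ((1 - 2 * t) * x)).
  rewrite (_ : g = horner (1 - 'X * (1 - 'X) * x%:P)%R); last first.
    by apply/funext => s; rewrite /g !hornerE.
  apply: (is_derive_eq (is_derive_poly _ _)).
  by rewrite !poly.derivE !hornerE; ring.
have s0 : 0 < Num.sqrt (g t) by rewrite sqrtr_gt0.
have ds := @is_derive1_comp _ Num.sqrt g t _ _ (is_derive1_sqrt g0) dg.
have := @is_deriveV _ (Num.sqrt \o g) t _ 1 (lt0r_neq0 s0) ds.
move/is_derive_eq; apply; rewrite /= -/(g t).
by rewrite /GRing.scale /=; field; rewrite gt_eqF.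
Qed.

(* The chord from [U] to [V] has Gram matrix [1 - t (1 - t) D], with
   [D = (U - V)^T (U - V)]; these matrices are simultaneously diagonalizable,
   so that, in an eigenbasis of [D], the polar factor of the chord is obtained
   by normalizing each column. *)
Lemma distE_chord_le {R : realType} {n p} (U V : 'M[R]_(n, p)) :
  St U -> St V -> frob_norm (U - V) <= 1 ->
  (distE U V <= (3 * frob_norm (U - V))%:E)%E.
Proof.
move=> hU hV d1; pose D := (U - V)^T *m (U - V).
have hD : psd_mx D := psd_mx_gram _.
have [W [x [hW DE]]] := real_spectral D (proj1 hD).
have WW : W *m W^T = 1%:M by apply: mulmx1C.
have x0 : forall k, 0 <= x 0 k by apply: (psd_spectral_ge0 W) => //; rewrite -DE.
have [u uE] : exists u, u = U *m W^T by eexists.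
have [v vE] : exists v, v = V *m W^T by eexists.
have [E EE] : exists E, E = v - u by eexists.
have uu : u^T *m u = 1%:M by rewrite uE trmx_mul trmxK mulmxA -(mulmxA W) hU mulmx1.
have vv : v^T *m v = 1%:M by rewrite vE trmx_mul trmxK mulmxA -(mulmxA W) hV mulmx1.
have EEx : E^T *m E = diag_mx x.
  have -> : E = - ((U - V) *m W^T) by rewrite EE uE vE mulmxBl opprB.
  rewrite [(- _)^T]linearN /= mulNmx mulmxN opprK trmx_mul trmxK mulmxA -(mulmxA W) -/D DE.
  by rewrite !mulmxA WW mul1mx -mulmxA WW mulmx1.
have delta2 : frob_norm (U - V) ^+ 2 = \sum_k x 0 k.
  rewrite frob_norm_sqr /frob_inner -/D DE -mulmxA mxtrace_mulC -mulmxA WW mulmx1.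
  by rewrite mxtrace_diag.
have x1 k : x 0 k <= 1.
  apply: (@le_trans _ _ (frob_norm (U - V) ^+ 2)).
    by rewrite delta2 (bigD1 k) //= lerDl sumr_ge0.
  by rewrite expr_le1 ?frob_norm_ge0.
pose g k t : R := 1 - t * (1 - t) * x 0 k.
(* [t (1 - t) <= 1/4] for every real [t], and each [x_k] is at most the squared length of the chord,
   hence at most 1. *)
have g34 k t : 3 / 4 <= g k t.
  rewrite /g; have := x0 k; have := x1 k; have : t * (1 - t) <= 1 / 4.
    by have := sqr_ge0 (t - 1 / 2); rewrite expr2; lra.
  by move=> *; nra.
have g0 k t : 0 < g k t by apply: lt_le_trans (g34 k t); lra.
pose f k t := (Num.sqrt (g k t))^-1.
have f2 k t : f k t ^+ 2 = (g k t)^-1 by rewrite /f exprVn sqr_sqrtr ?ltW.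
pose f' k t := (1 - 2 * t) * x 0 k / 2 * f k t ^+ 3.
have df k t : is_derive t (1 : R) (f k) (f' k t) by apply: is_derive_invsqrt_chord; exact: g0.
pose m t := u + t *: E.
have tE : E^T = v^T - u^T by rewrite EE linearB.
have uEv : u^T *m E + E^T *m u = - (E^T *m E).
  rewrite tE EE mulmxBr !mulmxBl !mulmxBr uu vv.
  by apply/matrixP => a b; rewrite !mxE; ring.
(* Columns [k] of [u] and of [u + E] are both unit vectors, so
   [2 <u_k, E_k> = - |E_k|^2 = - x_k]. *)
have uEk k : (E^T *m u) k k = - x 0 k / 2.
  have := congr1 (fun M : 'M[R]_p => M k k) uEv.
  have -> : u^T *m E = (E^T *m u)^T by rewrite trmx_mul trmxK.
  by rewrite EEx; move: (E^T *m u) => M; rewrite !mxE eqxx mulr1n; lra.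
have mm t : (m t)^T *m m t = diag_mx (\row_k g k t).
  apply/matrixP => i j.
  have -> : (m t)^T *m m t = u^T *m u + t *: (u^T *m E + E^T *m u) + (t ^+ 2) *: (E^T *m E).
    rewrite /m [_^T]linearD /= [(t *: E)^T]linearZ /= !mulmxDr !mulmxDl.
    rewrite -!scalemxAl -!scalemxAr scalerA -expr2 scalerDr.
    by rewrite addrACA !addrA.
  rewrite uEv EEx uu !mxE /g; case: eqVneq => _; rewrite ?mulr1n ?mulr0n; ring.
pose c t := m t *m diag_mx (\row_k f k t) *m W.
pose d t := (E *m diag_mx (\row_k f k t) + m t *m diag_mx (\row_k f' k t)) *m W.
have f1 k t : t * (1 - t) = 0 -> f k t = 1.
  by rewrite /f /g => ->; rewrite mul0r subr0 sqrtr1 invr1.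
have diag1 t : t * (1 - t) = 0 -> diag_mx (\row_k f k t) = 1%:M.
  move=> ht; rewrite -diag_const_mx; congr diag_mx; apply/rowP => k.
  by rewrite !mxE f1.
apply: (@distE_le_of_curve _ _ _ _ _ c d).
- by rewrite /c diag1 ?mul0r// mulmx1 /m scale0r addr0 uE -mulmxA hW mulmx1.
- rewrite /c diag1 ?subrr ?mulr0// mulmx1 /m scale1r EE addrC subrK.
  by rewrite vE -mulmxA hW mulmx1.
- move=> t _; rewrite /St /= /c !trmx_mul tr_diag_mx !mulmxA.
  rewrite -(mulmxA _ (m t)^T) mm -(mulmxA W^T) mulmx_diag -(mulmxA W^T) mulmx_diag.
  rewrite (_ : \row_j _ = const_mx 1) ?diag_const_mx ?mulmx1//.
  apply/rowP => k; rewrite !mxE mulrAC -expr2 f2 mulVf ?gt_eqF//.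
- move=> t; apply: is_derive_mx => i j.
  have -> : (fun s => c s i j) =
      \sum_(k < p) ((fun s => (u i k + s * E i k) * f k s) * cst (W k j)).
    apply/funext => s; rewrite fct_sumE /c mul_mx_diag mxE.
    by apply: eq_bigr => k _; rewrite !mxE.
  have -> : d t i j = \sum_k (E i k * f k t + (u i k + t * E i k) * f' k t) * W k j.
    by rewrite /d !mul_mx_diag mxE; apply: eq_bigr => k _; rewrite !mxE.
  apply: is_derive_sum => k.
  have dm : is_derive t (1 : R) (fun s => u i k + s * E i k) (E i k).
    rewrite (_ : (fun s => _) = horner ((u i k)%:P + 'X * (E i k)%:P)); last first.
      by apply/funext => s; rewrite !hornerE.
    by apply: (is_derive_eq (is_derive_poly _ _)); rewrite !poly.derivE !hornerE; ring.
  apply: (is_derive_eq (is_deriveM (is_deriveM dm (df k t)) (is_derive_cst _ _ _))).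
  by rewrite /= /GRing.scale /=; ring.
- move=> t; apply/cvg_mxP => i j.
  have dE s : d s i j = \sum_k (E i k * f k s + (u i k + s * E i k) * f' k s) * W k j.
    by rewrite /d !mul_mx_diag mxE; apply: eq_bigr => k _; rewrite !mxE.
  rewrite dE; under eq_fun do rewrite dE.
  have cf k : f k @ t --> f k t.
    by apply/differentiable_continuous/derivable1_diffP; apply: ex_derive.
  apply: cvg_sum => k; apply: cvgM; last exact: cvg_cst.
  apply: cvgD; first by apply: cvgM; [exact: cvg_cst|exact: cf].
  apply: cvgM.
    by apply: cvgD; [exact: cvg_cst|apply: cvgM; [exact: cvg_id|exact: cvg_cst]].
  apply: cvgM; last exact: (cvgM (cf k) (cvgM (cf k) (cf k))).
  do 2! (apply: cvgM; last exact: cvg_cst).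
  by apply: cvgB; [exact: cvg_cst|apply: cvgM; [exact: cvg_cst|exact: cvg_id]].
- move=> t; rewrite -ler_sqr ?nnegrE ?mulr_ge0 ?frob_norm_ge0// exprMn delta2.
  rewrite /d frob_norm_mulmx_orthor // frob_norm_sqr.
  rewrite frob_innerDl !(frob_innerC _ (_ + _)) !frob_innerDl !frob_inner_mul_diag.
  rewrite -!big_split mulr_sumr /=; apply: ler_sum => k _.
  have Em : (E^T *m m t) k k = (t - 1 / 2) * x 0 k.
    rewrite /m mulmxDr -scalemxAr EEx mxE uEk [X in _ + X]mxE [diag_mx x k k]mxE eqxx mulr1n.
    by lra.
  have mE : ((m t)^T *m E) k k = (t - 1 / 2) * x 0 k.
    by rewrite -Em -[(m t)^T *m E]trmxK trmx_mul trmxK mxE.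
  rewrite mE Em EEx mm !mxE eqxx !mulr1n.
  set G := g k t; set X := x 0 k; set F := f k t.
  have hF : F ^+ 2 * G = 1 by rewrite f2 mulVf // gt_eqF.
  have G34 : 3 / 4 <= G := g34 k t.
  have X0 : 0 <= X := x0 k.
  have F2 : F ^+ 2 <= 4 / 3.
    by rewrite f2 -[leRHS]invf_div lef_pV2 ?posrE.
  set y := (1 - 2 * t) * X.
  have fE : f' k t = y / 2 * F ^+ 3 by [].
  have e4 : F ^+ 3 * F ^+ 3 * G = F ^+ 4.
    by rewrite -exprD (_ : (3 + 3 = 4 + 2)%N)// exprD -mulrA hF mulr1.
  (* This is the exact squared speed of the normalized column [k]: [F ^+ 2 * X] is that of the chord
     after scaling, and the subtracted term is its radial part. What remains is at most [4/3 X],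
     below the required [9 X]. *)
  apply: (@le_trans _ _ (F ^+ 2 * X - (y / 2) ^+ 2 * F ^+ 4)).
    rewrite fE le_eqVlt; apply/orP; left; apply/eqP.
    have -> : y / 2 * F ^+ 3 * (y / 2 * F ^+ 3) * G = (y / 2) ^+ 2 * F ^+ 4 by rewrite -e4; ring.
    by rewrite /y; field; rewrite ?pnatr_eq0.
  have h1 : 0 <= (y / 2) ^+ 2 * F ^+ 4 by rewrite mulr_ge0 ?sqr_ge0// exprn_even_ge0.
  have h2 : F ^+ 2 * X <= 4 / 3 * X by rewrite ler_wpM2r.
  by lra.
Qed.

(** * Arcsine *)

Lemma sin_le {R : realType} (x : R) : 0 <= x -> sin x <= x.
Proof.
move=> x0; have cs : {within `[0, x], continuous (@sin R)}.
  by apply: continuous_subspaceT => y; exact: continuous_sin.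
have [c _] := MVT_segment x0 (fun y _ => is_derive_sin y) cs.
by rewrite sin0 !subr0 => ->; rewrite -[leRHS]mul1r ler_wpM2r //.
Qed.

Lemma asin_ge {R : realType} (x : R) : 0 <= x <= 1 -> x <= asin x.
Proof.
move=> /andP[x0 x1]; have x11 : -1 <= x <= 1 by rewrite x1 (le_trans _ x0)// lerN10.
have [a0|a0] := leP 0 (asin x).
  by rewrite -[leLHS]asinK ?in_itv //= sin_le.
have := asinK (x := x); rewrite in_itv /= => /(_ x11) e.
have : 0 < sin (- asin x).
  apply: sin_gt0_pi; rewrite oppr_gt0 a0 /= ltrNl.
  apply: lt_le_trans (asin_geNpi2 x11).
  by rewrite ltrN2 ltr_pdivrMr// ltr_pMr ?pi_gt0// ltr1n.
by rewrite sinN e oppr_gt0 ltNge x0.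
Qed.

Lemma asin0 {R : realType} : asin 0 = 0 :> R.
Proof.
by rewrite -[X in asin X]sin0 sinK // in_itv /= oppr_le0 divr_ge0 ?pi_ge0.
Qed.

(** By the mean value theorem [asin x = x / s] with [s = sqrt (1 - c^2)] and [|c| <= |x|]. The
    factor 2 comes from [1 - s <= 1 - s^2 = c^2] and [s >= 1/2]. *)
Lemma asin_sub_le {R : realType} (x : R) :
  `|x| <= 1 / 2 -> `|asin x - x| <= 2 * `|x| ^+ 3.
Proof.
move=> hx; have [x1 x2] : - (1 / 2) <= x /\ x <= 1 / 2 by apply/andP; rewrite -ler_norml.
pose df (y : R) := (Num.sqrt (1 - y ^+ 2))^-1.
have dasin (y : R) : `|y| <= `|x| -> is_derive y 1 asin (df y).
  move=> yx; apply: is_derive1_asin; rewrite -ltr_norml.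
  by rewrite (le_lt_trans (le_trans yx hx))// ltr_pdivrMr// mul1r ltr1n.
have [c cx E] : exists2 c : R, `|c| <= `|x| & asin x = df c * x.
  have cont a b : (forall y, y \in `[a, b] -> `|y| <= `|x|) ->
      {within `[a, b], continuous (@asin R)}.
    move=> ab; apply: continuous_in_subspaceT => y; rewrite inE => yab.
    by have dy := dasin y (ab y yab); apply/differentiable_continuous/derivable1_diffP.
  have [x0|/ltW x0] := leP 0 x.
    have ab y : y \in `[0, x] -> `|y| <= `|x|.
      by rewrite in_itv /= => /andP[y0 yx]; rewrite !ger0_norm.
    have dI y : y \in `]0, x[ -> is_derive y 1 asin (df y).
      by move=> yI; apply/dasin/ab; move: yI; rewrite !in_itv /= => /andP[/ltW -> /ltW ->].
    have [c cI] := MVT_segment x0 dI (cont _ _ ab).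
    by rewrite asin0 !subr0 => ->; exists c => //; exact: ab.
  have ab y : y \in `[x, 0] -> `|y| <= `|x|.
    by rewrite in_itv /= => /andP[y0 yx]; rewrite !ler0_norm ?lerN2.
  have dI y : y \in `]x, 0[ -> is_derive y 1 asin (df y).
    by move=> yI; apply/dasin/ab; move: yI; rewrite !in_itv /= => /andP[/ltW -> /ltW ->].
  have [c cI] := MVT_segment x0 dI (cont _ _ ab).
  rewrite asin0 !sub0r mulrN => /oppr_inj ->; by exists c => //; exact: ab.
set s := Num.sqrt (1 - c ^+ 2) in E.
have c2 : c ^+ 2 <= `|x| ^+ 2.
  by rewrite -[c ^+ 2]real_normK ?num_real// ler_sqr ?nnegrE.
have xx : `|x| ^+ 2 <= 1 / 4 by have := normr_ge0 x; nra.
have s2 : s ^+ 2 = 1 - c ^+ 2 by rewrite sqr_sqrtr //; lra.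
have s0 : 0 <= s := sqrtr_ge0 _.
have sh : 1 / 2 <= s by rewrite -ler_sqr ?nnegrE// s2; lra.
have s1 : s <= 1 by rewrite -ler_sqr ?nnegrE// s2 expr1n; have := sqr_ge0 c; lra.
have -> : asin x - x = (s^-1 - 1) * x by rewrite E mulrBl mul1r.
have h1 : 0 <= s^-1 - 1 <= 2 * `|x| ^+ 2.
  have si : 1 <= s^-1 by rewrite invf_ge1// (lt_le_trans _ sh)// divr_gt0.
  rewrite subr_ge0 si /=; have : s^-1 * s = 1.
    by rewrite mulVf // gt_eqF// (lt_le_trans _ sh)// divr_gt0.
  move: s^-1 si => r si rs.
  have : (r - 1) * s = 1 - s by rewrite mulrBl mul1r rs.
  have : 1 - s <= c ^+ 2 by nra.
  by nra.
rewrite normrM [X in X * _]ger0_norm; last by case/andP: h1.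
by rewrite exprSr mulrA ler_wpM2r//; case/andP: h1.
Qed.

(** * Interpolation error *)

Lemma orthogonal_mx_sign {R : realType} {n} (e : 'rV[R]_n) :
  (forall j, e 0 j = 1 \/ e 0 j = -1) -> orthogonal_mx (diag_mx e).
Proof.
move=> he; rewrite /orthogonal_mx tr_diag_mx mulmx_diag -diag_const_mx.
congr diag_mx; apply/rowP => j; rewrite !mxE.
by case: (he j) => ->; rewrite ?mulrNN mulr1.
Qed.

Lemma frob_norm_PhiB {R : realType} {p q} (Q : 'M[R]_(p + q)) (S : 'M[R]_p) U V :
  orthogonal_mx Q -> orthogonal_mx S ->
  frob_norm (Phi Q S U - Phi Q S V) = frob_norm (U - V).
Proof.
move=> hQ hS; rewrite /Phi -mulmxBl -mulmxBr frob_norm_mulmx_orthor//.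
by rewrite frob_norm_mulmx_orthol//; exact: orthogonal_mx_tr.
Qed.

Lemma St_Phi {R : realType} {p q} (Q : 'M[R]_(p + q)) (S : 'M[R]_p) U :
  orthogonal_mx Q -> orthogonal_mx S -> St (Phi Q S U) -> St U.
Proof.
move=> hQ hS; have QQ : Q *m Q^T = 1%:M by apply: mulmx1C.
have SS : S *m S^T = 1%:M by apply: mulmx1C.
rewrite /St /Phi /= !trmx_mul trmxK !mulmxA -(mulmxA _ Q) QQ mulmx1.
move=> /(congr1 (fun M => S *m M *m S^T)); rewrite mulmx1 SS !mulmxA SS mul1mx.
by rewrite -mulmxA SS mulmx1.
Qed.

Lemma asin_expansion {R : realType} :
  (fun h : R => 2 * asin (3 / 2 * h)) =
    (fun h : R => 3 * h) +O_ (0 : R) (fun h : R => h ^+ 3).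
Proof.
have N : \forall x \near (0 : R), `|x| <= 1 / 3 by apply: nbhs0_le; rewrite divr_gt0.
apply/eqaddOP; near=> k; near=> h.
have -> : ((fun h => 2 * asin (3 / 2 * h)) - (fun h => 3 * h)) h =
    2 * (asin (3 / 2 * h) - 3 / 2 * h) :> R.
  by rewrite -[LHS]/(2 * asin (3 / 2 * h) - 3 * h); field.
have h3 : `|h| <= 1 / 3 by near: h; exact: N.
have hx : `|3 / 2 * h| = 3 / 2 * `|h| by rewrite normrM ger0_norm.
have := @asin_sub_le R (3 / 2 * h); rewrite hx.
have -> : 3 / 2 * `|h| <= 1 / 2 by lra.
move=> /(_ isT) H.
rewrite normrM ger0_norm// normrX.
(* [27/2 = 2 * 2 * (3/2)^3]; the radius [1/3] brings [3 h / 2] into the range of [asin_sub_le]. *)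
apply: (@le_trans _ _ (27 / 2 * `|h| ^+ 3)); last by rewrite ler_wpM2r.
by move: H; rewrite exprMn; move: (asin _ - _) (`|h| ^+ 3) => a b; lra.
Unshelve. all: by end_near. Qed.

Theorem corollary3p7 (R : realType) (p q : nat) (p_gt0 : (0 < p)%N)
  (* the transformation Phi_(Q,S) *)
  (Uhat : 'M[R]_(p + q, p)) (hUhat : St Uhat)
  (Q : 'M[R]_(p + q)) (hQ : orthogonal_mx Q)
  (e : 'rV[R]_p) (he : forall j, e 0 j = 1 \/ e 0 j = -1)
  (hQUhat : Q^T *m Uhat = col_mx (diag_mx e) 0)
  (S : 'M[R]_p) (hS : S = StE^T *m Q^T *m Uhat)
  (* the sampled function *)
  (I : set R) (hI : is_interval I)
  (F : R -> 'M[R]_(p + q, p)) (hF : forall t, I t -> St (F t))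
  (F_diff : differentiable_within I F)
  (m : nat) (m_gt0 : (0 < m)%N) (t_ : 'I_m -> R)
  (ht_I : forall i, I (t_ i))
  (ht_lt : forall i j : 'I_m, (i < j)%N -> t_ i < t_ j)
  (h_samples : forall i, psi_dom (Phi Q S (F (t_ i))))
  (* the interpolant of the local coordinates *)
  (gamma : R -> 'M[R]_(p + q, p))
  (hgamma : forall t, I t -> phi_dom (gamma t))
  (hgamma_t : forall i, gamma (t_ i) = psiE (Phi Q S (F (t_ i))))
  (* true and interpolated data at tstar *)
  (tstar : R) (htstar : I tstar)
  (U Utilde : 'M[R]_(p + q, p))
  (hU : F tstar = U) (hUtilde : interpolant Q S gamma tstar = Utilde)
  (hU_dom : psi_dom (Phi Q S U))
  (hUtilde_dom : psi_dom (Phi Q S Utilde))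
  (X Xtilde : 'M[R]_(p + q, p))
  (hX : X = psiE (Phi Q S U)) (hXtilde : Xtilde = psiE (Phi Q S Utilde)) :
  (3 / 2 * frob_norm (X - Xtilde) <= 1 ->
    (distE (F tstar) (interpolant Q S gamma tstar)
       <= (2 * asin (3 / 2 * frob_norm (X - Xtilde)))%:E)%E) /\
  ((fun h : R => 2 * asin (3 / 2 * h)) =
     (fun h : R => 3 * h) +O_ (0 : R) (fun h : R => h ^+ 3)).
Proof.
have SE : S = diag_mx e.
  by rewrite hS -mulmxA hQUhat tr_col_mx mul_row_col trmx1 mul1mx mulmx0 addr0.
have hSo : orthogonal_mx S by rewrite SE; exact: orthogonal_mx_sign.
split; last exact: asin_expansion.
move=> h1; rewrite hU hUtilde.
(* [Phi] preserves Frobenius norms, so the chart estimate transfers to [U - Utilde], and the curve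
   is drawn between [U] and [Utilde] themselves. *)
have UX : frob_norm (U - Utilde) <= frob_norm (X - Xtilde).
  by rewrite -(frob_norm_PhiB Q S) // hX hXtilde; exact: psiE_expansive.
have X0 := frob_norm_ge0 (X - Xtilde).
apply: (@le_trans _ _ (3 * frob_norm (U - Utilde))%:E).
  apply: distE_chord_le; [| |lra].
    by rewrite -hU; exact: hF.
  by case: hUtilde_dom => hSt _ _; exact: St_Phi hQ hSo hSt.
rewrite lee_fin.
have : 3 / 2 * frob_norm (X - Xtilde) <= asin (3 / 2 * frob_norm (X - Xtilde)).
  by apply: asin_ge; rewrite h1 andbT mulr_ge0.
by lra.
Qed.
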